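(* Let $Q=(X,E,r,s,\lambda)$ and $Q'=(X',E',r',s',\lambda')$ be topological quivers. Suppose there are a homeomorphism $\varphi:X\to X'$, a measurable homeomorphism $\psi:E\to E'$ and a family of constants $\{h_y>0 : y\in X\}$ satisfying (1) $\varphi(s(e))=s'(\psi(e))$, (2) $\varphi(r(e))=r'(\psi(e))$, (3) $\lambda'_{\varphi(y)}(B)=\int_B h_y\,d(\lambda_y\circ\psi^{-1})$, for each $e\in E$, each measurable $B\subseteq E'$ and each $y\in X$. Then $$\mathcal O(K,\mathcal E_Q)\cong\mathcal O(K',\mathcal E_{Q'})$$ for any closed ideal $K'$ of $J(\mathcal E_{Q'})$, where $K=\varphi^\#(K')$.
   Context: A topological quiver $Q=(X,E,r,s,\lambda)$ consists of second countable locally compact Hausdorff spaces $X$ and $E$, continuous maps $r,s:E\to X$ with $r$ open, and a family $\lambda=\{\lambda_y\}_{y\in X}$ of Radon measures on $E$ such that $\operatorname{supp}\lambda_y=r^{-1}(y)$ for all $y\in X$ and, for each $f\in C_c(E)$, the function $y\mapsto\int_E f\,d\lambda_y$ lies in $C_c(X)$. The $C^*$-correspondence $\mathcal E_Q$ over $A=C_0(X)$ is the completion of $C_c(E)$ for the norm $\|\xi\|=\|\langle\xi,\xi\rangle\|_\infty^{1/2}$, where $\langle\xi,\eta\rangle(y)=\int_{r^{-1}(y)}\overline{\xi}\,\eta\,d\lambda_y$, with left and right actions $(a\cdot\xi\cdot b)(e)=a(s(e))\xi(e)b(r(e))$; the left action is the $*$-homomorphism $\phi:A\to\mathcal L(\mathcal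 E_Q)$, $\phi(a)\xi=a\cdot\xi$. For a $C^*$-correspondence $\mathcal E$ over $A$ with left action $\phi$: a representation $(T,\pi)$ of $\mathcal E$ in a $C^*$-algebra $B$ is a linear map $T:\mathcal E\to B$ and a $*$-homomorphism $\pi:A\to B$ with $T(\xi)^*T(\eta)=\pi(\langle\xi,\eta\rangle)$ and $T(\phi(a)\xi)=\pi(a)T(\xi)$. It induces $\Psi_T:\mathcal K(\mathcal E)\to B$, $\Psi_T(\theta_{\xi,\eta})=T(\xi)T(\eta)^*$, where $\theta_{\xi,\eta}(\zeta)=\xi\langle\eta,\zeta\rangle$ and $\mathcal K(\mathcal E)$ is the closed span of the $\theta_{\xi,\eta}$. Put $J(\mathcal E)=\phi^{-1}(\mathcal K(\mathcal E))$. For a closed ideal $K$ of $J(\mathcal E)$, $(T,\pi)$ is coisometric on $K$ if $\Psi_T(\phi(a))=\pi(a)$ for all $a\in K$. The relative Cuntz-Pimsner algebra $\mathcal O(K,\mathcal E)$ is the $C^*$-algebra generated by the universal representation coisometric on $K$. For a homeomorphism $\varphi:X\to X'$, $\varphi^\#:C_0(X')\to C_0(X)$ is $\varphi^\#(a')=a'\circ\varphi$. The measure $\lambda_y\circ\psi^{-1}$ is $B\mapsto\lambda_y(\psi^{-1}(B))$ on $E'$. *)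

(* Defs.v *)
From HB Require Import structures.
From mathcomp Require Import all_boot all_order all_algebra complex.
From mathcomp Require Import all_classical all_reals all_analysis ring lra.
Set Warnings "-redundant-canonical-projection,-projection-no-head-constant".
Set Implicit Arguments.
Unset Strict Implicit.
Unset Printing Implicit Defensive.
Import Order.TTheory GRing.Theory Num.Theory.
Import numFieldNormedType.Exports.
Local Open Scope classical_set_scope.
Local Open Scope ring_scope.
Definition cplx (R : realType) : numClosedFieldType := R[i].
Section cplx_theory.
Context {R : realType}.
Local Notation C := (cplx R).
Implicit Types z w : C.

Definition cabs z : R := complex.Re `|z|.

Lemma cabsE z : `|z| = (cabs z)%:C%C :> C.
Proof. by rewrite /cabs [RHS](@RRe_real R `|z : R[i]|)// normr_real. Qed.

Lemma cabs_ge0 z : 0 <= cabs z.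
Proof. by have := normr_ge0 z; rewrite cabsE (@ler0c R). Qed.

Lemma cabs0_eq0 z : cabs z = 0 -> z = 0.
Proof. by move=> z0; apply/normr0_eq0; rewrite cabsE z0. Qed.

Lemma cabs0 : cabs 0 = 0.
Proof. by rewrite /cabs normr0. Qed.

Lemma cabsD z w : cabs (z + w) <= cabs z + cabs w.
Proof.
have := ler_normD z w.
by rewrite !cabsE -(rmorphD (real_complex R)) (@lecR R).
Qed.

Lemma cabsM z w : cabs (z * w) = cabs z * cabs w.
Proof.
apply: (@complexI R); have := normrM z w.
by rewrite !cabsE -(rmorphM (real_complex R)).
Qed.

Lemma cabsJ z : cabs z^* = cabs z.
Proof. by rewrite /cabs norm_conjC. Qed.

Lemma cabsN z : cabs (- z) = cabs z.
Proof. by rewrite /cabs normrN. Qed.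


Lemma eps_cplx (e : C) : 0 < e -> exists2 r : R, 0 < r & e = r%:C%C.
Proof.
move=> e0; exists (complex.Re e).
  by move: e0; rewrite (@ltcE R) => /andP[].
by rewrite (@RRe_real R)// gtr0_real.
Qed.

Lemma cplx_dist_lt {T} {F : set_system T} {FF : Filter F} (f : T -> C) z :
  (f x @[x --> F] --> z) <->
  forall e : R, 0 < e -> \forall x \near F, cabs (z - f x) < e.
Proof.
split=> [/cvgrPdist_lt fz e e0|fz].
  have e0' : 0 < (e%:C%C : C) by rewrite (@ltcR R).
  have := fz _ e0'; apply: filterS => x.
  by rewrite cabsE (@ltcR R).
apply/cvgrPdist_lt => _ /eps_cplx[e e0 ->]; apply: filterS (fz e e0) => x.
by rewrite cabsE (@ltcR R).
Qed.

Lemma cabs_lerB z w : `|cabs z - cabs w| <= cabs (z - w).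
Proof.
rewrite ler_norml; apply/andP; split.
- rewrite lerNl opprB lerBlDr -(cabsN (z - w)) opprB.
  by apply: le_trans (cabsD _ _); rewrite subrK.
- by rewrite lerBlDr; apply: le_trans (cabsD _ _); rewrite subrK.
Qed.

Lemma cabs_continuous : continuous (cabs : C -> R).
Proof.
move=> z; apply/(@cvgrPdist_lt _ _ _ _ (nbhs_filter z)) => e e0.
have e0' : 0 < (e%:C%C : C) by rewrite (@ltcR R).
apply: (@filterS _ (nbhs z) (nbhs_filter z) (ball z (e%:C%C : C)) _ _ (nbhsx_ballx z _ e0')).
move=> w; rewrite -ball_normE /ball_ /= cabsE (@ltcR R).
by apply: le_lt_trans; exact: cabs_lerB.
Qed.

Lemma cabs_Re z : `|complex.Re z| <= cabs z.
Proof.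
by have := @normc_ge_Re R z; rewrite -[`|z|]/(`|z : C|) cabsE (@lecR R).
Qed.

Lemma cabs_Im z : `|complex.Im z| <= cabs z.
Proof.
have := cabs_Re (z * ('i)%C); rewrite (@ReiNIm R) normrN cabsM.
suff -> : cabs ('i)%C = 1 by rewrite mulr1.
by rewrite /cabs (@normc_def R) /= expr0n expr1n add0r sqrtr1.
Qed.

Lemma cabs_leD z : cabs z <= `|complex.Re z| + `|complex.Im z|.
Proof.
have {1}-> : z = (complex.Re z)%:C%C + (('i)%C * (complex.Im z)%:C%C) :> C.
  exact: (@complexE R z).
apply: (le_trans (cabsD _ _)); rewrite cabsM.
have -> : cabs ('i)%C = 1.
  by rewrite /cabs (@normc_def R) /= expr0n expr1n add0r sqrtr1.
rewrite mul1r /cabs !(@normc_def R) /= expr0n !addr0 !sqrtr_sqr.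
by [].
Qed.

Lemma cplx_complete (F : set_system C) : ProperFilter F -> cauchy F -> cvg F.
Proof.
move=> FF /cauchyP Fc.
have FcR (p : C -> R) : {morph p : x y / x - y} -> (forall z, `|p z| <= cabs z) ->
    cvg (p @ F).
  move=> pB pn; have pF : ProperFilter (p @ F) by exact: fmap_proper_filter.
  apply: cauchy_cvg; apply/(@cauchyP _ _ _ pF) => e e0.
  have e0' : 0 < (e%:C%C : C) by rewrite (@ltcR R).
  have [z Fz] := Fc _ e0'; exists (p z); rewrite /=.
  apply: filterS Fz => w; rewrite -!ball_normE /ball_ /= cabsE (@ltcR R).
  by apply: le_lt_trans; rewrite -pB.
have /cvg_ex[a aP] : cvg ((@complex.Re R : C -> R) @ F).
  by apply: FcR; [case=> ? ? [? ?]|exact: cabs_Re].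
have /cvg_ex[b bP] : cvg ((@complex.Im R : C -> R) @ F).
  by apply: FcR; [case=> ? ? [? ?]|exact: cabs_Im].
apply/cvg_ex; exists (Complex a b : C).
apply/(@cplx_dist_lt _ F _ id) => e e0.
have e20 : 0 < e / 2 by rewrite divr_gt0.
move/cvgrPdist_lt : aP => /(_ _ e20) Fa.
move/cvgrPdist_lt : bP => /(_ _ e20) Fb.
near=> z; apply: (le_lt_trans (cabs_leD _)).
rewrite [e]splitr ltrD//.
- suff -> : complex.Re ((Complex a b : C) - z) = a - complex.Re z by near: z.
  by case: (z).
- suff -> : complex.Im ((Complex a b : C) - z) = b - complex.Im z by near: z.
  by case: (z).
Unshelve. all: by end_near. Qed.

End cplx_theory.

Section c0.
Context (R : realType) (X : topologicalType).
Local Notation C := (cplx R).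
Implicit Types (f g : X -> C).

Definition vanishes_at_infinity f :=
  forall e : R, 0 < e ->
    exists2 K, compact K & forall x, ~ K x -> cabs (f x) < e.

Definition c0 : {pred X -> C} :=
  mem [set f | continuous f /\ vanishes_at_infinity f].

Lemma c0P f : reflect (continuous f /\ vanishes_at_infinity f) (f \in c0).
Proof. by apply: (iffP idP) => [/set_mem//|/mem_set]. Qed.

Lemma c0_bounded f : f \in c0 -> exists M : R, forall x, cabs (f x) <= M.
Proof.
move=> /c0P[fc fv]; have [K Kc Kf] := fv 1 ltr01.
have : compact ((cabs \o f) @` K).
  apply: continuous_compact Kc; apply: continuous_subspaceT => x.
  by apply: continuous_comp; [exact: fc|exact: cabs_continuous].
move=> /compact_bounded[M [_ MP]].
exists (Num.max (M + 1) 1) => x; have [Kx|nKx] := pselect (K x).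
  rewrite le_max; apply/orP; left.
  by rewrite -[X in X <= _]ger0_norm ?cabs_ge0//; apply: MP; [rewrite ltrDl|exists x].
by rewrite le_max (ltW (Kf _ nKx)) orbT.
Qed.

Lemma c0_approx f :
  (forall e : R, 0 < e -> exists2 g, g \in c0 & forall x, cabs (g x - f x) <= e) ->
  f \in c0.
Proof.
move=> fP; apply/c0P; split=> [x|e e0].
- apply/(@cplx_dist_lt _ _ _ (nbhs_filter x)) => e e0.
  have e30 : 0 < e / 3 by rewrite divr_gt0.
  have [g /c0P[gc _] gf] := fP _ e30.
  have := (@cplx_dist_lt _ _ _ (nbhs_filter x) g (g x)).1 (gc x) _ e30.
  apply: filterS => y gxy.
  have -> : f x - f y = (f x - g x) + ((g x - g y) + (g y - f y)).
    by rewrite !addrA !subrK.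
  apply: (le_lt_trans (cabsD _ _)).
  have -> : e = e / 3 + (e / 3 + e / 3) by field.
  apply: ler_ltD; first by rewrite -cabsN opprB.
  by apply: (le_lt_trans (cabsD _ _)); rewrite ltr_leD.
- have e20 : 0 < e / 2 by rewrite divr_gt0.
  have [g /c0P[_ gv] gf] := fP _ e20.
  have [K Kc Kg] := gv _ e20; exists K => // x nKx.
  rewrite -(subrK (g x) (f x)) [e]splitr.
  apply: (le_lt_trans (cabsD _ _)); apply: ler_ltD; last exact: Kg.
  by rewrite -cabsN opprB.
Qed.

Lemma c0_submod_closed : submod_closed c0.
Proof.
split=> [|a f g /c0P[fc fv] /c0P[gc gv]].
  apply/c0P; split=> [x|e e0]; first exact: cvg_cst.
  by exists set0; [exact: compact0|move=> x _; rewrite cabs0].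
apply/c0P; split=> [x|e e0].
  by apply: cvgD; [apply: cvgM; [exact: cvg_cst|exact: fc]|exact: gc].
have e20 : 0 < e / 2 by rewrite divr_gt0.
have a1 : 0 < cabs a + 1 by rewrite ltr_wpDl ?cabs_ge0.
have [K Kc Kf] := fv (e / 2 / (cabs a + 1)) (divr_gt0 e20 a1).
have [L Lc Lg] := gv _ e20.
exists (K `|` L); first exact: compactU.
move=> x /not_orP[nKx nLx]; rewrite [e]splitr.
rewrite [X in cabs X](_ : _ = a * f x + g x)//.
apply: (le_lt_trans (cabsD _ _)); apply: ler_ltD; last exact: Lg.
rewrite cabsM.
apply: (@le_trans _ _ ((cabs a + 1) * (e / 2 / (cabs a + 1)))).
  by apply: ler_pM; rewrite ?cabs_ge0 ?lerDl// ltW// Kf.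
by rewrite mulrC divfK ?gt_eqF.
Qed.

HB.instance Definition _ := GRing.isSubmodClosed.Build _ _ c0 c0_submod_closed.

Record C0 := MkC0 { c0_fun :> X -> C; c0_funP : c0_fun \in c0 }.

HB.instance Definition _ := [isSub for c0_fun].
HB.instance Definition _ := [Choice of C0 by <:].
HB.instance Definition _ := [SubChoice_isSubLmodule of C0 by <:].

Lemma C0_ext (f g : C0) : (forall x, f x = g x) -> f = g.
Proof. by move=> fg; apply/val_inj/funext. Qed.

Definition supnorm (f : C0) : R := sup [set cabs (f x) | x in [set: X]].

Lemma supnorm_ub (f : C0) x : cabs (f x) <= supnorm f.
Proof.
apply: ub_le_sup; last by exists x.
have [M MP] := c0_bounded (c0_funP f); exists M => y [z _ <-].
exact: MP.
Qed.

Lemma supnorm_le (f : C0) (M : R) :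
  0 <= M -> (forall x, cabs (f x) <= M) -> supnorm f <= M.
Proof.
move=> M0 fM; have [[x _]|X0] := pselect (exists x : X, True).
  apply: ge_sup => [|z [y _ <-]]; last exact: fM.
  by exists (cabs (f x)), x.
rewrite /supnorm (_ : [set _ | _ in _] = set0) ?sup0//.
by apply/seteqP; split=> // y [x _ _]; apply: X0; exists x.
Qed.

Lemma supnorm_ge0 (f : C0) : 0 <= supnorm f.
Proof.
have [[x _]|X0] := pselect (exists x : X, True).
  exact: le_trans (cabs_ge0 _) (supnorm_ub f x).
rewrite /supnorm (_ : [set _ | _ in _] = set0) ?sup0//.
by apply/seteqP; split=> // y [x _ _]; apply: X0; exists x.
Qed.

Let nrm (f : C0) : C := ((supnorm f)%:C)%C.

Let nrmD (f g : C0) : nrm (f + g) <= nrm f + nrm g.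
Proof.
rewrite /nrm -(rmorphD (real_complex R)) (@lecR R).
apply: supnorm_le => [|x]; first by rewrite addr_ge0 ?supnorm_ge0.
by apply: (le_trans (cabsD _ _)); rewrite lerD ?supnorm_ub.
Qed.

Let nrmZ (a : C) (f : C0) : nrm (a *: f) = `|a| * nrm f.
Proof.
rewrite /nrm cabsE -(rmorphM (real_complex R)); congr (_%:C)%C.
have le (b : C) (g : C0) : supnorm (b *: g) <= cabs b * supnorm g.
  apply: supnorm_le => [|x]; first by rewrite mulr_ge0 ?cabs_ge0 ?supnorm_ge0.
  by rewrite [c0_fun _ _](_ : _ = b * g x)// cabsM ler_wpM2l ?cabs_ge0 ?supnorm_ub.
apply/eqP; rewrite eq_le le/=.
have [->|a0] := eqVneq a 0; first by rewrite cabs0 mul0r supnorm_ge0.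
have ca0 : 0 < cabs a.
  by rewrite lt_def cabs_ge0 andbT; apply: contra_neq a0 => /cabs0_eq0.
rewrite -ler_pdivlMl// -[X in supnorm X <= _](scalerK a0).
apply: (le_trans (le _ _)); rewrite ler_wpM2r ?supnorm_ge0//.
rewrite -(ler_pM2l ca0) -cabsM (divff a0) divff ?gt_eqF//.
by rewrite /cabs normr1.
Qed.

Let nrm0 (f : C0) : nrm f = 0 -> f = 0.
Proof.
move=> f0; apply: C0_ext => x; apply: cabs0_eq0; apply/eqP.
rewrite eq_le cabs_ge0 andbT; apply: (le_trans (supnorm_ub f x)).
by move/(@complexI R) : f0 => ->.
Qed.

HB.instance Definition _ := Lmodule_isNormed.Build C C0 nrmD nrmZ nrm0.

Lemma C0_normE (f : C0) : `|f| = (supnorm f)%:C%C.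
Proof. by []. Qed.

Let C0_complete (F : set_system C0) : ProperFilter F -> cauchy F -> cvg F.
Proof.
move=> FF /cauchyP Fc.
have Fe (e : R) : 0 < e ->
    exists f0 : C0, \forall f \near F, supnorm (f0 - f) < e.
  move=> e0; have e0' : 0 < (e%:C%C : C) by rewrite (@ltcR R).
  have [f0 Ff0] := Fc _ e0'; exists f0; apply: filterS Ff0 => f.
  by rewrite -ball_normE /ball_ /= C0_normE (@ltcR R).
have Fx x : cvg ((fun f : C0 => f x : C) @ F).
  apply: cplx_complete; apply: cauchy_exP => _ /eps_cplx[e e0 ->].
  have [f0 Ff0] := Fe _ e0; exists (f0 x); apply: filterS Ff0 => f.
  rewrite -ball_normE /ball_ /= cabsE (@ltcR R); apply: le_lt_trans.
  exact: (supnorm_ub (f0 - f) x).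
pose l x : C := lim ((fun f : C0 => f x : C) @ F).
have Fl (e : R) (f0 : C0) : 0 < e -> (\forall f \near F, supnorm (f0 - f) < e) ->
    forall x, cabs (f0 x - l x) <= e.
  move=> e0 Ff0 x; apply/ler_addgt0Pr => d d0.
  have /cplx_dist_lt/(_ _ d0) Fd : (fun f : C0 => f x : C) @ F --> l x by exact: Fx.
  have [f [/= f0f lf]] := filter_ex (filterI Ff0 Fd).
  rewrite -(subrK (f x) (f0 x)) -addrA; apply: (le_trans (cabsD _ _)).
  apply: lerD; last by rewrite -cabsN opprB ltW.
  by apply: (le_trans _ (ltW f0f)); exact: (supnorm_ub (f0 - f) x).
have lP : l \in c0.
  apply: c0_approx => e e0; have [f0 Ff0] := Fe _ e0.
  by exists f0; [exact: c0_funP|exact: Fl].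
apply/cvg_ex; exists (MkC0 lP).
apply/(@cvgrPdist_lt _ _ _ F FF id) => _ /eps_cplx[e e0 ->].
have e30 : 0 < e / 3 by rewrite divr_gt0.
have [f0 Ff0] := Fe _ e30; apply: filterS (Ff0) => f f0f.
rewrite C0_normE (@ltcR R).
apply: (@le_lt_trans _ _ (e / 3 + e / 3)).
  apply: supnorm_le => [|x]; first by rewrite addr_ge0 ?ltW.
  rewrite [c0_fun _ _](_ : _ = (l x - f0 x) + (f0 x - f x)); last first.
    by rewrite addrA subrK.
  apply: (le_trans (cabsD _ _)); apply: lerD.
    by rewrite -cabsN opprB; exact: Fl.
  by apply: (le_trans _ (ltW f0f)); exact: (supnorm_ub (f0 - f) x).
lra.
Qed.

HB.instance Definition _ := Uniform_isComplete.Build C0 C0_complete.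

Lemma c0_mul f g : f \in c0 -> g \in c0 -> (fun x => f x * g x) \in c0.
Proof.
move=> /[dup] /c0P[fc fv] /c0_bounded[M MP] /c0P[gc gv].
apply/c0P; split=> [x|e e0]; first by apply: cvgM; [exact: fc|exact: gc].
have M0 : 0 < `|M| + 1 by rewrite ltr_wpDl.
have [K Kc Kg] := gv (e / (`|M| + 1)) (divr_gt0 e0 M0).
exists K => // x nKx; rewrite cabsM.
apply: (@le_lt_trans _ _ ((`|M| + 1) * cabs (g x))).
  rewrite ler_wpM2r ?cabs_ge0//; apply: (le_trans (MP x)).
  by apply: (le_trans (ler_norm M)); rewrite lerDl.
by rewrite mulrC -ltr_pdivlMr// Kg.
Qed.

Lemma c0_conj f : f \in c0 -> (fun x => (f x)^*) \in c0.
Proof.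
move=> /c0P[fc fv]; apply/c0P; split=> [x|e e0].
  apply/(@cplx_dist_lt _ _ _ (nbhs_filter x)) => e e0.
  have := (@cplx_dist_lt _ _ _ (nbhs_filter x) f (f x)).1 (fc x) _ e0.
  by apply: filterS => y; rewrite -rmorphB cabsJ.
by have [K Kc Kf] := fv _ e0; exists K => // x /Kf; rewrite cabsJ.
Qed.

End c0.

(* C*-algebras, not assumed unital; the norm of a normed module over [cplx R]
   takes its values in the nonnegative elements of [cplx R]. *)
HB.mixin Record isCStarAlgebra (R : realType) A
    & CompleteNormedModule (cplx R) A := {
  cmul : A -> A -> A;
  cadj : A -> A;
  cmulA : associative cmul;
  cmulDl : left_distributive cmul +%R;
  cmulDr : right_distributive cmul +%R;
  cmulZl : forall (c : cplx R) x y, cmul (c *: x) y = c *: cmul x y;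
  cmulZr : forall (c : cplx R) x y, cmul x (c *: y) = c *: cmul x y;
  cadjK : involutive cadj;
  cadjD : {morph cadj : x y / x + y};
  cadjZ : forall (c : cplx R) x, cadj (c *: x) = c^* *: cadj x;
  cadjM : forall x y, cadj (cmul x y) = cmul (cadj y) (cadj x);
  cmul_norm : forall x y, `|cmul x y| <= `|x| * `|y|;
  cstar_norm : forall x, `|cmul (cadj x) x| = `|x| ^+ 2
}.

#[short(type="cstarAlgType")]
HB.structure Definition CStarAlgebra (R : realType) :=
  {A of CompleteNormedModule (cplx R) A & isCStarAlgebra R A}.

Section C0_cstar.
Context (R : realType) (X : topologicalType).
Local Notation C := (cplx R).
Local Notation A := (C0 R X).

Definition C0_mul (f g : A) : A := MkC0 (c0_mul (c0_funP f) (c0_funP g)).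
Definition C0_conj (f : A) : A := MkC0 (c0_conj (c0_funP f)).

Let C0_mulA : associative C0_mul.
Proof. by move=> f g h; apply: C0_ext => x; exact: mulrA. Qed.
Let C0_mulDl : left_distributive C0_mul +%R.
Proof. by move=> f g h; apply: C0_ext => x; exact: mulrDl. Qed.
Let C0_mulDr : right_distributive C0_mul +%R.
Proof. by move=> f g h; apply: C0_ext => x; exact: mulrDr. Qed.
Let C0_mulZl (c : C) (f g : A) : C0_mul (c *: f) g = c *: C0_mul f g.
Proof. by apply: C0_ext => x; exact/esym/mulrA. Qed.
Let C0_mulZr (c : C) (f g : A) : C0_mul f (c *: g) = c *: C0_mul f g.
Proof. by apply: C0_ext => x; exact: (@mulrCA C (f x) c (g x)). Qed.
Let C0_conjK : involutive C0_conj.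
Proof. by move=> f; apply: C0_ext => x; exact: conjCK. Qed.
Let C0_conjD : {morph C0_conj : f g / f + g}.
Proof. by move=> f g; apply: C0_ext => x; exact: rmorphD. Qed.
Let C0_conjZ (c : C) (f : A) : C0_conj (c *: f) = c^* *: C0_conj f.
Proof. by apply: C0_ext => x; exact: (@rmorphM C C Num.conj c (f x)). Qed.
Let C0_conjM (f g : A) : C0_conj (C0_mul f g) = C0_mul (C0_conj g) (C0_conj f).
Proof. by apply: C0_ext => x; rewrite /= mulrC; exact: rmorphM. Qed.

Let C0_mul_norm (f g : A) : `|C0_mul f g| <= `|f| * `|g|.
Proof.
rewrite !C0_normE -(rmorphM (real_complex R)) (@lecR R).
apply: supnorm_le => [|x]; first by rewrite mulr_ge0 ?supnorm_ge0.
by rewrite /= cabsM ler_pM ?cabs_ge0 ?supnorm_ub.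
Qed.

Let C0_cstar_norm (f : A) : `|C0_mul (C0_conj f) f| = `|f| ^+ 2.
Proof.
rewrite !C0_normE -(rmorphXn (real_complex R)); congr (_%:C)%C.
apply/eqP; rewrite eq_le; apply/andP; split.
  apply: supnorm_le => [|x]; first by rewrite exprn_ge0 ?supnorm_ge0.
  by rewrite /= cabsM cabsJ -expr2 lerXn2r ?nnegrE ?cabs_ge0 ?supnorm_ge0 ?supnorm_ub.
set s := supnorm (C0_mul _ _); have s0 : 0 <= s by exact: supnorm_ge0.
suff fs : supnorm f <= Num.sqrt s.
  apply: (@le_trans _ _ (Num.sqrt s ^+ 2)); last by rewrite (sqr_sqrtr s0).
  by rewrite ler_pXn2r// ?nnegrE ?supnorm_ge0 ?sqrtr_ge0.
apply: supnorm_le => [|x]; first exact: sqrtr_ge0.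
rewrite -[leLHS](ger0_norm (cabs_ge0 _)) -sqrtr_sqr ler_wsqrtr//.
have := supnorm_ub (C0_mul (C0_conj f) f) x.
by rewrite /= cabsM cabsJ -expr2.
Qed.

HB.instance Definition _ := isCStarAlgebra.Build R A
  C0_mulA C0_mulDl C0_mulDr C0_mulZl C0_mulZr C0_conjK C0_conjD C0_conjZ
  C0_conjM C0_mul_norm C0_cstar_norm.

End C0_cstar.

Record star_hom (R : realType) (A B : cstarAlgType R) (f : A -> B) : Prop := {
  star_hom_linear : linear f;
  star_homM : {morph f : x y / cmul x y};
  star_hom_adj : {morph f : x / cadj x}
}.

Definition cstar_isomorphic (R : realType) (A B : cstarAlgType R) : Prop :=
  exists2 f : A -> B, star_hom f & bijective f.

Record star_subalgebra (R : realType) (A : cstarAlgType R) (D : set A) : Prop := {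
  star_subalgebra0 : D 0;
  star_subalgebra_lin : forall (c : cplx R) x y, D x -> D y -> D (c *: x + y);
  star_subalgebraM : forall x y, D x -> D y -> D (cmul x y);
  star_subalgebra_adj : forall x, D x -> D (cadj x)
}.

Definition cstar_generated (R : realType) (A : cstarAlgType R) (S : set A) : Prop :=
  forall D : set A, closed D -> star_subalgebra D -> S `<=` D -> D = [set: A].

Record closed_ideal_of (R : realType) (A : cstarAlgType R) (J K : set A) : Prop := {
  closed_ideal_sub : K `<=` J;
  closed_ideal_closed : closed K;
  closed_ideal0 : K 0;
  closed_ideal_lin : forall (c : cplx R) x y, K x -> K y -> K (c *: x + y);
  closed_idealMl : forall x y, J x -> K y -> K (cmul x y);
  closed_idealMr : forall x y, K x -> J y -> K (cmul x y)
}.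

(* A C*-correspondence over [A]: a right Hilbert [A]-module [E], whose inner
   product [cip] is linear in its second argument, and a *-homomorphism
   [a |-> lact a] from [A] to the adjointable operators of [E]. *)
HB.mixin Record isCorrespondence (R : realType) (A : cstarAlgType R) E
    & CompleteNormedModule (cplx R) E := {
  cip : E -> E -> A;
  ract : E -> A -> E;
  lact : A -> E -> E;
  cipDr : forall x y z, cip x (y + z) = cip x y + cip x z;
  cipZr : forall (c : cplx R) x y, cip x (c *: y) = c *: cip x y;
  cip_ract : forall x y a, cip x (ract y a) = cmul (cip x y) a;
  cip_adj : forall x y, cadj (cip x y) = cip y x;
  cip_pos : forall x, exists a, cip x x = cmul (cadj a) a;
  cip_norm : forall x, `|x| ^+ 2 = `|cip x x|;
  ractDl : forall x y a, ract (x + y) a = ract x a + ract y a;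
  ractDr : forall x a b, ract x (a + b) = ract x a + ract x b;
  ractZl : forall (c : cplx R) x a, ract (c *: x) a = c *: ract x a;
  ractZr : forall (c : cplx R) x a, ract x (c *: a) = c *: ract x a;
  ractM : forall x a b, ract x (cmul a b) = ract (ract x a) b;
  lactD : forall a b x, lact (a + b) x = lact a x + lact b x;
  lactZ : forall (c : cplx R) a x, lact (c *: a) x = c *: lact a x;
  lactM : forall a b x, lact (cmul a b) x = lact a (lact b x);
  lact_adj : forall a x y, cip (lact a x) y = cip x (lact (cadj a) y)
}.

#[short(type="correspondenceType")]
HB.structure Definition Correspondence (R : realType) (A : cstarAlgType R) :=
  {E of CompleteNormedModule (cplx R) E & isCorrespondence R A E}.

Section correspondence_theory.
Context (R : realType) (A : cstarAlgType R) (E : correspondenceType A).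
Local Notation C := (cplx R).

Definition rank_one (x y : E) : E -> E := fun z => ract x (cip y z).

Definition adjoint_pair (t u : E -> E) : Prop :=
  forall x y, cip (t x) y = cip x (u y).

Definition finite_rank : set (E -> E) :=
  [set t | exists n (x y : 'I_n -> E), t = \sum_(i < n) rank_one (x i) (y i)].

(* The closed span of the [rank_one x y] among the adjointable operators, for
   the operator norm; scalars are absorbed by the vectors [x]. *)
Definition compact_operator : set (E -> E) :=
  [set t | (exists u, adjoint_pair t u) /\
    forall e : C, 0 < e ->
      exists2 s, finite_rank s & forall z, `|t z - s z| <= e * `|z|].

Definition Jideal : set A := [set a | compact_operator (lact a : E -> E)].

Section representation.
Context (B : cstarAlgType R).
Implicit Types (T : E -> B) (pi : A -> B) (Psi : (E -> E) -> B).

Record representation T pi : Prop := {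
  rep_linear : linear T;
  rep_star_hom : star_hom pi;
  rep_cip : forall x y, cmul (cadj (T x)) (T y) = pi (cip x y);
  rep_lact : forall a x, T (lact a x) = cmul (pi a) (T x)
}.

(* [Psi] restricts to the *-homomorphism [Psi_T] on the compact operators *)
Record induced_by T Psi : Prop := {
  induced_linear : forall (c : C) t u, compact_operator t -> compact_operator u ->
    Psi (c *: t + u) = c *: Psi t + Psi u;
  inducedM : forall t u, compact_operator t -> compact_operator u ->
    Psi (t \o u) = cmul (Psi t) (Psi u);
  induced_adj : forall t u, compact_operator t -> compact_operator u ->
    adjoint_pair t u -> Psi u = cadj (Psi t);
  induced_rank_one : forall x y, Psi (rank_one x y) = cmul (T x) (cadj (T y))
}.

Definition coisometric_on (K : set A) T pi : Prop :=
  exists2 Psi, induced_by T Psi & forall a, K a -> Psi (lact a) = pi a.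

End representation.

(* The algebra [cp_alg] generated by the universal representation of [E] that
   is coisometric on [K]; unique up to isomorphism. *)
Record relative_cuntz_pimsner (K : set A) := RelativeCuntzPimsner {
  cp_alg :> cstarAlgType R;
  cp_T : E -> cp_alg;
  cp_pi : A -> cp_alg;
  cp_rep : representation cp_T cp_pi;
  cp_coisometric : coisometric_on K cp_T cp_pi;
  cp_generated : cstar_generated (range cp_T `|` range cp_pi);
  cp_universal : forall (B : cstarAlgType R) (T : E -> B) (pi : A -> B),
    representation T pi -> coisometric_on K T pi ->
    exists! rho : cp_alg -> B,
      [/\ star_hom rho, rho \o cp_T = T & rho \o cp_pi = pi]
}.

End correspondence_theory.

Definition Cc (R : realType) (T : topologicalType) : set (T -> cplx R) :=
  [set f | continuous f /\ compact (closure [set x | f x != 0])].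
Arguments Cc : clear implicits.

(* Measurable types of the library are pointed; a base point is therefore
   carried along, and no point is needed in what follows. *)
Definition pointed_at (T : topologicalType) (x0 : T) : Type := T.

Section pointed_at.
Context (T : topologicalType) (x0 : T).
HB.instance Definition _ := Topological.copy (pointed_at x0) T.
HB.instance Definition _ := isPointed.Build (pointed_at x0) x0.
End pointed_at.

Definition borel_at (T : topologicalType) (x0 : T) :=
  g_sigma_algebraType (@open (pointed_at x0)).

Definition borel (T : topologicalType) : set (set T) := <<s @open T >>.

Section borel_measures.
Context (R : realType) (T : topologicalType).
Implicit Types (mu : set T -> \bar R) (D : set T).

(* The first clause only matters when [T] is empty. *)
Definition borel_measure mu : Prop :=
  mu set0 = 0%E /\
  forall x0 : T, exists m : {measure set (borel_at x0) -> \bar R}, mu = m.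

Record radon_measure mu : Prop := {
  radon_borel : borel_measure mu;
  radon_finite : forall K, compact K -> (mu K < +oo)%E;
  radon_outer : forall A, borel A ->
    mu A = ereal_inf [set mu U | U in [set U | open U /\ A `<=` U]];
  radon_inner : forall U, open U ->
    mu U = ereal_sup [set mu K | K in [set K | compact K /\ K `<=` U]]
}.

Definition measure_support mu : set T :=
  [set x | forall U, open_nbhs x U -> (0 < mu U)%E].

(* The library integral does not depend on the base point; over the empty
   space the integral is 0. *)
Definition borel_integral mu D (f : T -> \bar R) : \bar R :=
  if pselect (exists x0 : T, True) is left xT then
    \int[(mu : set (borel_at (projT1 (cid xT))) -> \bar R)]_(x in D) f x
  else 0%E.

Definition cplx_integral mu D (f : T -> cplx R) : cplx R :=
  Complex (fine (borel_integral mu D (fun x => (complex.Re (f x))%:E)))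
          (fine (borel_integral mu D (fun x => (complex.Im (f x))%:E))).

End borel_measures.

Record topological_quiver (R : realType) := TopologicalQuiver {
  vert : topologicalType;
  edge : topologicalType;
  qr : edge -> vert;
  qs : edge -> vert;
  qlambda : vert -> set edge -> \bar R;
  vert_second_countable : @second_countable vert;
  vert_locally_compact : locally_compact [set: vert];
  vert_hausdorff : hausdorff_space vert;
  edge_second_countable : @second_countable edge;
  edge_locally_compact : locally_compact [set: edge];
  edge_hausdorff : hausdorff_space edge;
  qr_continuous : continuous qr;
  qs_continuous : continuous qs;
  qr_open : forall U, open U -> open (qr @` U);
  qlambda_radon : forall y, radon_measure (qlambda y);
  qlambda_support : forall y, measure_support (qlambda y) = qr @^-1` [set y];
  qlambda_Cc : forall f, Cc R edge f ->
    Cc R vert (fun y => cplx_integral (qlambda y) [set: edge] f)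
}.

(* The correspondence over [C0 R (vert Q)] obtained by completing [Cc R (edge Q)];
   [qc_iota] is only relevant on [Cc R (edge Q)], where it is the canonical map
   to the completion. *)
Record quiver_correspondence (R : realType) (Q : topological_quiver R) :=
    QuiverCorrespondence {
  qc_corr :> correspondenceType (C0 R (vert Q));
  qc_iota : (edge Q -> cplx R) -> qc_corr;
  qc_linear : forall (c : cplx R) xi eta, Cc R (edge Q) xi -> Cc R (edge Q) eta ->
    qc_iota (c *: xi + eta) = c *: qc_iota xi + qc_iota eta;
  qc_dense : closure (qc_iota @` Cc R (edge Q)) = [set: qc_corr];
  qc_cip : forall xi eta, Cc R (edge Q) xi -> Cc R (edge Q) eta ->
    forall y, cip (qc_iota xi) (qc_iota eta) y =
      cplx_integral (qlambda y) (@qr R Q @^-1` [set y]) (fun e => (xi e)^* * eta e);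
  qc_lact : forall (a : C0 R (vert Q)) xi, Cc R (edge Q) xi ->
    lact a (qc_iota xi) = qc_iota (fun e => a (qs e) * xi e);
  qc_ract : forall (b : C0 R (vert Q)) xi, Cc R (edge Q) xi ->
    ract (qc_iota xi) b = qc_iota (fun e => xi e * b (qr e))
}.

Definition homeomorphism (T U : topologicalType) (f : T -> U) : Prop :=
  continuous f /\
  exists g : U -> T, [/\ continuous g, cancel f g & cancel g f].

Definition measurable_homeomorphism (T U : topologicalType) (f : T -> U) : Prop :=
  homeomorphism f /\ forall B, borel B -> borel (f @^-1` B).

Lemma c0_pullback (R : realType) (X X' : topologicalType) (phi : X -> X')
    (f : X' -> cplx R) :
  homeomorphism phi -> f \in @c0 R X' -> f \o phi \in @c0 R X.
Proof.
move=> [phic [g [gc phiK gK]]] /c0P[fc fv]; apply/c0P; split=> [x|e e0].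
  exact: continuous_comp (phic x) (fc _).
have [K Kc Kf] := fv _ e0; exists (g @` K).
  by apply: continuous_compact Kc; exact: continuous_subspaceT.
move=> x nKx; apply: Kf => Kx; apply: nKx; exists (phi x) => //; exact: phiK.
Qed.

Definition C0_pullback (R : realType) (X X' : topologicalType) (phi : X -> X')
    (phiP : homeomorphism phi) (f : C0 R X') : C0 R X :=
  MkC0 (c0_pullback phiP (c0_funP f)).

(* Main.v *)
Require Import Defs.
From mathcomp Require Import all_boot all_order all_algebra complex.
From mathcomp Require Import all_classical all_reals all_analysis ring.
From mathcomp Require Import measurable_realfun.
Set Implicit Arguments.
Unset Strict Implicit.
Unset Printing Implicit Defensive.
Import Order.TTheory GRing.Theory Num.Theory.
Import numFieldNormedType.Exports.
Local Open Scope classical_set_scope.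
Local Open Scope ring_scope.

                                                              
                                                                                
                                                                               
                                                                               
                                                                             
                                                                       
                                                                          
                                                                        
                                                                            
                                                             

                                          

(** It suffices to find an isomorphism of correspondences from $\mathcal E_{Q'}$ to $\mathcal E_Q$
    lying over $\varphi^\#$: such a map transports compact operators, $J$, representations and
    coisometry, so the two universal properties give mutually inverse *-homomorphisms
    ([ci_cuntz_pimsner]).

    By (3), $\lambda'_{\varphi(y)}$ is $h_y$ times the image of $\lambda_y$ under $\psi$, so
    composition with $\psi$ alone changes inner products by the factor $h_y$. The map
    $\xi\mapsto\sqrt{h\circ r}\,(\xi\circ\psi)$ ([quiver_transport]) repairs this: the weight enters
    the inner product twice, and by (2) it is constant on each fibre of integration
    ([quiver_transport_cip]). By (1) it respects the left actions.

    The weight must preserve $C_c$, although nothing is assumed about how $h_y$ depends on $y$. This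
    is the crux, [weight_continuous]: for a bump function $F$ at $\psi(e)$, the functions
    $y\mapsto\int F\,d\lambda'_{\varphi(y)}$ and $y\mapsto\int F\circ\psi\,d\lambda_y$ are
    continuous by the quiver axioms, the second is positive at $r(e)$ because $\lambda_{r(e)}$ has
    full support in the fibre, and $h$ is their quotient near $r(e)$.

    Since the weight is positive, the transport is a bijection $C_c(E')\to C_c(E)$, and
    [correspondence_extension] carries it to the completions by density. *)

(** * Linear maps, continuity and dense sets in normed spaces *)

Section normed.
Context (R : realType).
Local Notation C := (cplx R).

Section linear.
Context (V W : lmodType C) (f : V -> W) (fl : linear f).

Lemma lin_add x y : f (x + y) = f x + f y.
Proof. by rewrite -[x in LHS]scale1r fl scale1r. Qed.

Lemma lin0 : f 0 = 0.
Proof. by apply: (addrI (f 0)); rewrite -lin_add !addr0. Qed.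

Lemma lin_scale c x : f (c *: x) = c *: f x.
Proof. by rewrite -[c *: x]addr0 fl lin0 addr0. Qed.

Lemma lin_sub x y : f (x - y) = f x - f y.
Proof. by rewrite lin_add -scaleN1r lin_scale scaleN1r. Qed.

Lemma lin_sum n (x : 'I_n -> V) : f (\sum_(i < n) x i) = \sum_(i < n) f (x i).
Proof. by apply: big_morph; [exact: lin_add|exact: lin0]. Qed.

Lemma lin_can (g : W -> V) : cancel f g -> cancel g f -> linear g.
Proof. by move=> fK gK c x y; rewrite -[in LHS](gK x) -[in LHS](gK y) -fl fK. Qed.

End linear.

Lemma bounded_additive_continuous (V W : normedModType C) (f : V -> W) (M : C) :
  0 <= M -> (forall x y, f (x - y) = f x - f y) ->
  (forall x, `|f x| <= M * `|x|) -> continuous f.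
Proof.
move=> M0 fB fM x.
apply/(@cvgrPdist_lt _ W V (nbhs x) (nbhs_filter x) f (f x)) => e e0.
have M1 : 0 < M + 1 by rewrite ltr_wpDl.
have := @cvgr_dist_lt _ V V (nbhs x) (nbhs_filter x) id x (@cvg_id V (nbhs x))
  (e / (M + 1)) (divr_gt0 e0 M1).
apply: filterS => y; rewrite -fB ltr_pdivlMr// mulrC; apply: le_lt_trans.
by apply: (le_trans (fM _)); rewrite ler_wpM2r ?lerDl.
Qed.

Lemma isometry_continuous (V W : normedModType C) (f : V -> W) :
  linear f -> (forall x, `|f x| = `|x|) -> continuous f.
Proof.
move=> fl fn; apply: (@bounded_additive_continuous _ _ _ 1) => // [|x].
- exact: lin_sub.
- by rewrite fn mul1r.
Qed.

Lemma continuous_dense_eq (T : topologicalType) (W : normedModType C)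
    (f g : T -> W) (D : set T) : continuous f -> continuous g ->
  closure D = [set: T] -> (forall x, D x -> f x = g x) -> f =1 g.
Proof.
move=> fc gc dD fg x; apply/eqP; rewrite -subr_eq0; apply/eqP.
have clK : closed ((fun x => f x - g x) @^-1` [set 0]).
  apply: preimage_closed; first by move=> y _; apply: cvgB; [exact: fc|exact: gc].
  apply: accessible_closed_set1; apply: hausdorff_accessible.
  exact: norm_hausdorff.
have : closure D x by rewrite dD.
have DK : D `<=` ((fun x => f x - g x) @^-1` [set 0]).
  by move=> y Dy /=; rewrite (fg _ Dy) subrr.
by move=> /(closureS DK); rewrite -((closure_id _).1 clK).
Qed.
End normed.

(** * Nondegeneracy and continuity of the inner product *)

Section cip_theory.
Context (R : realType) (A : cstarAlgType R) (E : correspondenceType A).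
Local Notation C := (cplx R).
Implicit Types (x y z : E) (c : C).

Lemma cipDl x y z : cip (x + y) z = cip x z + cip y z.
Proof. by rewrite -cip_adj cipDr cadjD !cip_adj. Qed.

Lemma cipZl c x z : cip (c *: x) z = c^* *: cip x z.
Proof. by rewrite -cip_adj cipZr cadjZ cip_adj. Qed.

Lemma cip0l x : cip 0 x = 0.
Proof. by have := cipZl 0 0 x; rewrite conjC0 !scale0r. Qed.

Lemma cip0r x : cip x 0 = 0.
Proof. by have := cipZr 0 x 0; rewrite !scale0r. Qed.

Lemma cipNr x y : cip x (- y) = - cip x y.
Proof. by rewrite -scaleN1r cipZr scaleN1r. Qed.

Lemma cipBr x y z : cip x (y - z) = cip x y - cip x z.
Proof. by rewrite cipDr cipNr. Qed.

Lemma cip_eq0 x : cip x x = 0 -> x = 0.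
Proof.
move=> x0; apply/normr0_eq0/eqP; rewrite -sqrf_eq0; apply/eqP.
by rewrite cip_norm x0 normr0.
Qed.

Lemma cip_inj y z : (forall x, cip x y = cip x z) -> y = z.
Proof.
move=> xyz; apply/eqP; rewrite -subr_eq0; apply/eqP/cip_eq0.
by rewrite cipBr xyz subrr.
Qed.

(** [cip_norm] controls only the diagonal values [cip x x]; polarization is what gives access to the
    others. *)
Lemma cip_polarization x y :
  2 *: cip x y = cip (x + y) (x + y) - 'i *: cip (x + 'i *: y) (x + 'i *: y)
    - (1 - 'i) *: (cip x x + cip y y).
Proof.
set a := cip x x; set b := cip x y; set c := cip y x; set d := cip y y.
have -> : cip (x + y) (x + y) = (a + d) + (b + c).
  by rewrite cipDl !cipDr -/a -/b -/c -/d [c + d]addrC addrACA.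
have -> : cip (x + 'i *: y) (x + 'i *: y) = (a + d) + 'i *: (b - c).
  rewrite cipDl !cipDr !cipZl !cipZr -/a -/b -/c -/d scalerA conjCi mulNr.
  rewrite -expr2 sqrCi opprK scale1r scalerBr scaleNr.
  by rewrite [- _ + d]addrC addrACA.
rewrite scalerDr scalerA -expr2 sqrCi scaleN1r scalerBl scale1r.
move: ('i *: (a + d)) (a + d) => u s.
rewrite scaler_nat mulr2n !opprB !addrA addrNK.
by rewrite [s + b + c + b]addrAC addrK -(addrA s) (addrC s) addrK.
Qed.

Lemma cip_bound_sum x y : `|cip x y| <= 3 * (`|x| + `|y|) ^+ 2.
Proof.
pose s := `|x| + `|y|.
have nx : `|x| <= s by rewrite lerDl.
have ny : `|y| <= s by rewrite lerDr.
have s0 : 0 <= s by rewrite addr_ge0.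
have ncip z : `|z| <= s -> `|cip z z| <= s ^+ 2.
  by move=> zs; rewrite -cip_norm lerXn2r ?nnegrE.
have i2 : `|1 - 'i : C| <= 2.
  by apply: (le_trans (ler_normB _ _)); rewrite normr1 normCi.
have : `|2 *: cip x y| <= 2 * (3 * s ^+ 2).
  rewrite cip_polarization; apply: (le_trans (ler_normB _ _)).
  (* One $s^2$ for each of the first two diagonal terms of the polarization, and $|1-i|\le 2$ times
     $2s^2$ for the last one. *)
  have -> : 2 * (3 * s ^+ 2) = (s ^+ 2 + s ^+ 2) + 2 * (s ^+ 2 + s ^+ 2) by ring.
  apply: lerD.
    apply: (le_trans (ler_normB _ _)); rewrite normrZ normCi mul1r lerD// ncip//.
      exact: ler_normD.
    by apply: (le_trans (ler_normD _ _)); rewrite normrZ normCi mul1r.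
  rewrite normrZ ler_pM//.
  by apply: (le_trans (ler_normD _ _)); rewrite lerD ?ncip.
by rewrite normrZ normr_nat ler_pM2l.
Qed.

(** A crude substitute for Cauchy-Schwarz, enough for continuity. Normalizing both vectors in
    [cip_bound_sum] gives the constant $3(1+1)^2=12$. *)
Lemma cip_bound x y : `|cip x y| <= 12 * (`|x| * `|y|).
Proof.
have [->|x0] := eqVneq x 0; first by rewrite cip0l !normr0 mul0r mulr0.
have [->|y0] := eqVneq y 0; first by rewrite cip0r !normr0 !mulr0.
have nx : `|x| != 0 by rewrite normr_eq0.
have ny : `|y| != 0 by rewrite normr_eq0.
have := cip_bound_sum (`|x|^-1 *: x) (`|y|^-1 *: y).
rewrite cipZl cipZr !normrZ norm_conjC !normfV !normr_id !mulVf//.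
have -> : 3 * (1 + 1) ^+ 2 = 12 :> C by ring.
by rewrite mulrA -invfM ler_pdivrMl ?mulr_gt0 ?normr_gt0// mulrC.
Qed.

Lemma cip_continuousl y : continuous (fun x => cip x y).
Proof.
apply: (@bounded_additive_continuous _ _ _ _ (12 * `|y|)) => [|x z|x].
- by rewrite mulr_ge0.
- by rewrite cipDl -[- z]scaleN1r cipZl rmorphN rmorph1 scaleN1r.
- by rewrite -mulrA [`|y| * _]mulrC cip_bound.
Qed.

Lemma cip_continuousr x : continuous (fun y => cip x y).
Proof.
apply: (@bounded_additive_continuous _ _ _ _ (12 * `|x|)) => [|y z|y].
- by rewrite mulr_ge0.
- by rewrite cipBr.
- by rewrite -mulrA cip_bound.
Qed.

Lemma lact_adjr a x y : cip x (lact a y) = cip (lact (cadj a) x) y.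
Proof. by rewrite lact_adj cadjK. Qed.

End cip_theory.

                                        

(** * Composition and inversion of *-homomorphisms *)

Section star_hom.
Context (R : realType).

Lemma star_hom_id (A : cstarAlgType R) : star_hom (@idfun A).
Proof. by split. Qed.

Lemma star_hom_comp (A B D : cstarAlgType R) (f : A -> B) (g : B -> D) :
  star_hom f -> star_hom g -> star_hom (g \o f).
Proof.
move=> [fl fM fa] [gl gM ga]; split=> [c x y|x y|x] /=.
- by rewrite fl gl.
- by rewrite fM gM.
- by rewrite fa ga.
Qed.

Lemma star_hom_can (A B : cstarAlgType R) (f : A -> B) (g : B -> A) :
  star_hom f -> cancel f g -> cancel g f -> star_hom g.
Proof.
move=> [fl fM fa] fK gK; split=> [|x y|x].
- exact: (lin_can fl fK gK).
- by rewrite -[in LHS](gK x) -[in LHS](gK y) -fM fK.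
- by rewrite -[in LHS](gK x) -fa fK.
Qed.

End star_hom.

(** * Isomorphisms of correspondences and their effect on relative Cuntz-Pimsner algebras *)

Section correspondence_iso.
Context (R : realType).
Local Notation C := (cplx R).

(** The inverses [beta] and [V] are explicit so that the notion can be reversed by exchanging
    arguments. Compatibility with the right actions is derived in [ci_ract]. *)
Record correspondence_iso (A A' : cstarAlgType R) (E : correspondenceType A)
    (E' : correspondenceType A') (alpha : A -> A') (beta : A' -> A)
    (U : E -> E') (V : E' -> E) : Prop := {
  ci_hom : star_hom alpha;
  ci_norm : forall a, `|alpha a| = `|a|;
  ci_algK : cancel alpha beta;
  ci_algVK : cancel beta alpha;
  ci_linear : linear U;
  ci_K : cancel U V;
  ci_VK : cancel V U;
  ci_cip : forall x y, cip (U x) (U y) = alpha (cip x y);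
  ci_lact : forall a x, U (lact a x) = lact (alpha a) (U x)
}.

Lemma correspondence_iso_sym (A A' : cstarAlgType R) (E : correspondenceType A)
    (E' : correspondenceType A') (alpha : A -> A') (beta : A' -> A)
    (U : E -> E') (V : E' -> E) :
  correspondence_iso alpha beta U V -> correspondence_iso beta alpha V U.
Proof.
move=> [ah an aK bK Ul UK VK Uc Ua]; split=> //.
- exact: star_hom_can ah aK bK.
- by move=> a; rewrite -an bK.
- exact: (lin_can Ul UK VK).
- by move=> x y; rewrite -[cip (V x) _]aK -Uc !VK.
- by move=> a x; rewrite -[in LHS](bK a) -[in LHS](VK x) -Ua UK.
Qed.

Section iso_operators.
Context (A A' : cstarAlgType R) (E : correspondenceType A)
  (E' : correspondenceType A') (alpha : A -> A') (beta : A' -> A)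
  (U : E -> E') (V : E' -> E) (I : correspondence_iso alpha beta U V).

Lemma ci_normU x : `|U x| = `|x|.
Proof.
apply/eqP; rewrite -(eqrXn2 (n := 2))//; apply/eqP.
by rewrite !cip_norm (ci_cip I) (ci_norm I).
Qed.

(** The inner product is nondegenerate and [U] is onto, so both sides are tested against vectors
    [U (V y)]. *)
Lemma ci_ract x a : U (ract x a) = ract (U x) (alpha a).
Proof.
apply: cip_inj => y; rewrite -(ci_VK I y) (ci_cip I) !cip_ract (ci_cip I).
exact: star_homM (ci_hom I) _ _.
Qed.

Lemma ci_rank_one x y : U \o rank_one x y \o V = rank_one (U x) (U y).
Proof.
by apply/funext => z /=; rewrite /rank_one ci_ract -(ci_cip I) (ci_VK I).
Qed.

Lemma ci_adjoint_pair t u :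
  adjoint_pair t u -> adjoint_pair (U \o t \o V) (U \o u \o V).
Proof.
move=> tu x y /=; rewrite -{1}(ci_VK I y) (ci_cip I) tu -(ci_cip I).
by rewrite (ci_VK I).
Qed.

Lemma ci_finite_rank s : finite_rank s -> finite_rank (U \o s \o V).
Proof.
move=> [n [x [y ->]]]; exists n, (U \o x), (U \o y).
apply/funext => z /=; rewrite !fct_sumE (lin_sum (ci_linear I)).
by apply: eq_bigr => i _; rewrite -ci_rank_one.
Qed.

(** Conjugation by the isometric pair [U], [V] sends finite rank operators to finite rank operators
    and keeps the approximation error [e] unchanged. *)
Lemma ci_compact_operator t :
  compact_operator t -> compact_operator (U \o t \o V).
Proof.
move=> [[u tu] ts]; split; first by exists (U \o u \o V); exact: ci_adjoint_pair.
move=> e /ts[s sf st]; exists (U \o s \o V); first exact: ci_finite_rank.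
move=> z /=; rewrite -(lin_sub (ci_linear I)) ci_normU.
by rewrite -[in X in _ <= X](ci_VK I z) ci_normU.
Qed.

Lemma ci_lact_conj a : U \o lact a \o V = lact (alpha a).
Proof. by apply/funext => x /=; rewrite (ci_lact I) (ci_VK I). Qed.

Lemma ci_Jideal a : Jideal E a -> Jideal E' (alpha a).
Proof. by move=> /ci_compact_operator; rewrite ci_lact_conj. Qed.

Lemma ci_continuous : continuous alpha.
Proof.
by apply: isometry_continuous; [exact: star_hom_linear (ci_hom I)|exact: ci_norm I].
Qed.

End iso_operators.

Section iso_universal.
Context (A A' : cstarAlgType R) (E : correspondenceType A)
  (E' : correspondenceType A') (alpha : A -> A') (beta : A' -> A)
  (U : E -> E') (V : E' -> E) (I : correspondence_iso alpha beta U V).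
Let I' := correspondence_iso_sym I.

(** Seen as a preimage under the continuous map [beta], the image inherits closedness and the ideal
    laws at once. *)
Lemma ci_image (K : set A) : [set alpha a | a in K] = beta @^-1` K.
Proof.
apply/seteqP; split=> [_ [a Ka <-]|a Ka]; first by rewrite /preimage/= (ci_algK I).
by exists (beta a) => //; exact: ci_algVK I a.
Qed.

Lemma ci_closed_ideal (K : set A) : closed_ideal_of (Jideal E) K ->
  closed_ideal_of (Jideal E') [set alpha a | a in K].
Proof.
move=> [KJ Kc K0 Kl Kml Kmr]; rewrite ci_image.
have [bl bM _] := ci_hom I'.
split=> [a Ka|||c x y Kx Ky|x y Jx Ky|x y Kx Jy].
- by rewrite -(ci_algVK I a); apply: (ci_Jideal I); exact: KJ.
- by apply: preimage_closed Kc => x _; exact: (ci_continuous I').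
- by rewrite /preimage/= (lin0 bl).
- by rewrite /preimage/= bl; exact: Kl.
- by rewrite /preimage/= bM; apply: Kml => //; exact: ci_Jideal I' _ Jx.
- by rewrite /preimage/= bM; apply: Kmr => //; exact: ci_Jideal I' _ Jy.
Qed.

Lemma ci_representation (B : cstarAlgType R) (T : E -> B) (pi : A -> B) :
  representation T pi -> representation (T \o V) (pi \o beta).
Proof.
move=> [Tl ph Tc Ta]; split=> [c x y|//|x y|a x] /=.
- by rewrite (ci_linear I') Tl.
- exact: star_hom_comp (ci_hom I') ph.
- by rewrite Tc (ci_cip I').
- by rewrite (ci_lact I') Ta.
Qed.

(** Operators on [E'] are first conjugated back to [E], where [Psi] lives. *)
Lemma ci_induced_by (B : cstarAlgType R) (T : E -> B) (Psi : (E -> E) -> B) :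
  induced_by T Psi -> induced_by (T \o V) (fun t => Psi (V \o t \o U)).
Proof.
move=> [Pl PM Pa P1]; have co := ci_compact_operator I'.
split=> [c t u tc uc|t u tc uc|t u tc uc tu|x y].
- rewrite -Pl; [|exact: co|exact: co]; congr Psi.
  by apply/funext => x /=; exact: (ci_linear I').
- rewrite -PM; [|exact: co|exact: co]; congr Psi.
  by apply/funext => x /=; rewrite (ci_VK I).
- by apply: Pa; [exact: co|exact: co|exact: ci_adjoint_pair I' _ _ tu].
- by rewrite (ci_rank_one I').
Qed.

Lemma ci_coisometric_on (K : set A) (B : cstarAlgType R) (T : E -> B) (pi : A -> B) :
  coisometric_on K T pi ->
  coisometric_on [set alpha a | a in K] (T \o V) (pi \o beta).
Proof.
move=> [Psi PT PK]; exists (fun t => Psi (V \o t \o U)); first exact: ci_induced_by.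
by move=> _ [a Ka <-]; rewrite (ci_lact_conj I') /= (ci_algK I) PK.
Qed.

(** The universal representation of [E] in [O], composed with [V] and [beta], is a representation of
    [E'] coisometric on [K']; universality of [O'] then yields [f]. *)
Lemma ci_cuntz_pimsner_hom (K : set A) (K' : set A')
    (O : relative_cuntz_pimsner E K) (O' : relative_cuntz_pimsner E' K') :
  K' = [set alpha a | a in K] ->
  exists f : O' -> O, [/\ star_hom f, f \o cp_T O' = cp_T O \o V &
    f \o cp_pi O' = cp_pi O \o beta].
Proof.
move=> KK'; have := ci_coisometric_on (cp_coisometric O); rewrite -KK'.
by move=> /(cp_universal O' (ci_representation (cp_rep O)))[f [fP _]]; exists f.
Qed.

End iso_universal.

(** Uniqueness in the universal property, with [O] itself as target: both [f] and the identity are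
    solutions. *)
Lemma cuntz_pimsner_endo (A : cstarAlgType R) (E : correspondenceType A)
    (K : set A) (O : relative_cuntz_pimsner E K) (f : O -> O) :
  star_hom f -> f \o cp_T O = cp_T O -> f \o cp_pi O = cp_pi O -> f =1 id.
Proof.
move=> fh fT fpi x.
have [g [_ gU]] := cp_universal O (cp_rep O) (cp_coisometric O).
rewrite -(gU f) //.
by rewrite (gU idfun) //; split => //; exact: star_hom_id.
Qed.

Lemma ci_cuntz_pimsner (A A' : cstarAlgType R) (E : correspondenceType A)
    (E' : correspondenceType A') (alpha : A -> A') (beta : A' -> A)
    (U : E -> E') (V : E' -> E) (I : correspondence_iso alpha beta U V)
    (K : set A) (O : relative_cuntz_pimsner E K)
    (O' : relative_cuntz_pimsner E' [set alpha a | a in K]) :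
  cstar_isomorphic O' O.
Proof.
have I' := correspondence_iso_sym I.
have [f [fh fT fpi]] := ci_cuntz_pimsner_hom I O O' erefl.
(* The reverse homomorphism comes from the inverse isomorphism, for which [K] must appear as an
   image under [beta]. *)
have KE : K = [set beta a' | a' in [set alpha a | a in K]].
  rewrite (ci_image I'); apply/seteqP; split=> a; first by exists a.
  by move=> [b Kb /(can_inj (ci_algK I)) <-].
have [g [gh gT gpi]] := ci_cuntz_pimsner_hom I' O' O KE.
exists f => //; exists g => x.
- apply: (@cuntz_pimsner_endo _ _ _ O' (g \o f)); first exact: star_hom_comp.
  + by rewrite -compA fT compA gT; apply/funext => y /=; rewrite (ci_VK I).
  + by rewrite -compA fpi compA gpi; apply/funext => y /=; rewrite (ci_algVK I).
- apply: (@cuntz_pimsner_endo _ _ _ O (f \o g)); first exact: star_hom_comp.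
  + by rewrite -compA gT compA fT; apply/funext => y /=; rewrite (ci_K I).
  + by rewrite -compA gpi compA fpi; apply/funext => y /=; rewrite (ci_algK I).
Qed.

End correspondence_iso.

                                       

(** * Extension of isometries from dense subsets *)

Section dense_isometry.
Context (R : realType).
Local Notation C := (cplx R).

Lemma continuous_compT (T1 T2 T3 : topologicalType) (f : T1 -> T2) (g : T2 -> T3) :
  continuous f -> continuous g -> continuous (g \o f).
Proof. by move=> fc gc x; apply: continuous_comp; [exact: fc|exact: gc]. Qed.

Lemma dense_image_dist (S : Type) (V : normedModType C) (D : set S) (i : S -> V) :
  closure (i @` D) = [set: V] ->
  forall x (e : C), 0 < e -> exists2 s, D s & `|i s - x| < e.
Proof.
move=> iD x e e0; have : closure (i @` D) x by rewrite iD.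
have nx : nbhs x (ball x e) by exact: nbhsx_ballx.
move=> /(_ _ nx)[_ [[s Ds <-] /=]]; rewrite -ball_normE /ball_ /= distrC.
by exists s.
Qed.

(** A point is determined by its distances to a dense set: take [i s] close to [x]; it is then
    equally close to [y]. *)
Lemma dense_image_eq (S : Type) (V : normedModType C) (D : set S) (i : S -> V) x y :
  closure (i @` D) = [set: V] ->
  (forall s, D s -> `|i s - x| = `|i s - y|) -> x = y.
Proof.
move=> iD xy; apply/eqP; rewrite -subr_eq0 -normr_le0.
apply/ler_addgt0Pr => e e0; rewrite add0r.
have e2 : 0 < e / 2 by rewrite divr_gt0.
have [s Ds sx] := dense_image_dist iD x e2.
rewrite [e]splitr; apply: (le_trans (ler_distD (i s) _ _)).
by rewrite lerD// ?[`|x - _|]distrC -?xy// ltW.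
Qed.

(** The point [y] is the limit of [j s] as [i s] tends to [x]. Describing it by distances pins it
    down ([dense_image_eq]) and treats [i] and [j] symmetrically, so the same lemma gives the
    inverse map. *)
Lemma dense_isometry_exists (S : Type) (V : normedModType C)
    (W : completeNormedModType C) (D : set S) (i : S -> V) (j : S -> W) :
  closure (i @` D) = [set: V] ->
  (forall s t, D s -> D t -> `|i s - i t| = `|j s - j t|) ->
  forall x, exists y, forall s, D s -> `|i s - x| = `|j s - y|.
Proof.
move=> iD ij x.
(* [F] is the filter of [j]-images of shrinking neighbourhoods of [x]; it is Cauchy because [j]
   reproduces the distances of [i]. *)
pose B (e : R) := [set j s | s in [set s | D s /\ `|i s - x| < (e%:C)%C]].
pose F := filter_from [set e : R | 0 < e] B.
have FF : Filter F.
  apply: filter_from_filter; first by exists 1; exact: ltr01.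
  move=> a b a0 b0; exists (Num.min a b); first by rewrite /= lt_min a0.
  move=> _ [s [Ds sx] <-].
  split; exists s => //; split=> //; apply: (lt_le_trans sx);
    by rewrite (@lecR R) ge_min lexx ?orbT.
have PF : ProperFilter F.
  apply: filter_from_proper => e e0.
  have e0' : 0 < (e%:C%C : C) by rewrite (@ltcR R).
  by have [s Ds sx] := dense_image_dist iD x e0'; exists (j s), s.
have Fe (e : R) : 0 < e -> exists2 s, D s & `|i s - x| < (e%:C)%C /\
    F (ball (j s) (e%:C%C : C)).
  move=> e0; have e20 : 0 < e / 2 by rewrite divr_gt0.
  have e20' : 0 < ((e / 2)%:C%C : C) by rewrite (@ltcR R).
  have [s Ds sx] := dense_image_dist iD x e20'.
  have eE : (e%:C)%C = ((e / 2)%:C)%C + ((e / 2)%:C)%C :> C.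
    by rewrite -(rmorphD (real_complex R)) -splitr.
  exists s => //; split; first by rewrite eE (lt_trans sx)// ltrDr.
  exists (e / 2) => // _ [t [Dt tx] <-].
  rewrite -ball_normE /ball_ /= -ij// eE.
  by apply: (le_lt_trans (ler_distD x _ _)); rewrite ltrD// distrC.
have Fc : cvg F.
  apply: cauchy_cvg; apply: cauchy_exP => _ /eps_cplx[e e0 ->].
  by have [s _ [_ Fs]] := Fe _ e0; exists (j s).
have [y Fy] := (cvg_ex F).1 Fc.
have near (e : R) : 0 < e -> exists2 t, D t &
    `|i t - x| < (e%:C)%C /\ `|j t - y| < (e%:C)%C.
  move=> e0; have e0' : 0 < (e%:C%C : C) by rewrite (@ltcR R).
  have Fb : F (ball y (e%:C%C : C)) by apply: Fy; exact: nbhsx_ballx.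
  have Fi : F (B e) by exists e.
  have [z [/= yz [t [Dt tx] tE]]] := filter_ex (filterI Fb Fi).
  exists t => //; split=> //; rewrite tE.
  by move: yz; rewrite -ball_normE /ball_ /= distrC.
exists y => s Ds; apply/eqP; rewrite eq_le; apply/andP; split;
  apply/ler_addgt0Pr => _ /eps_cplx[e e0 ->];
  have e20 : 0 < e / 2 by rewrite divr_gt0.
- have [t Dt [tx ty]] := near _ e20.
  rewrite [e]splitr (rmorphD (real_complex R)) addrA.
  apply: (le_trans (ler_distD (i t) _ _)).
  apply: lerD; last exact: ltW.
  rewrite ij//; apply: (le_trans (ler_distD y _ _)).
  by rewrite lerD// distrC ltW.
- have [t Dt [tx ty]] := near _ e20.
  rewrite [e]splitr (rmorphD (real_complex R)) addrA.
  apply: (le_trans (ler_distD (j t) _ _)).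
  apply: lerD; last exact: ltW.
  rewrite -ij//; apply: (le_trans (ler_distD x _ _)).
  by rewrite lerD// distrC ltW.
Qed.

(** Linearity on [D] turns equality of norms into equality of distances. The extensions [f] and [g]
    are chosen by their distances to the dense images, which makes them mutually inverse; linearity
    of [f] follows by continuity, one variable at a time. *)
Lemma dense_isometry_extension (S : lmodType C) (V W : completeNormedModType C)
    (D : set S) (i : S -> V) (j : S -> W) :
  (forall (c : C) s t, D s -> D t -> D (c *: s + t)) ->
  (forall (c : C) s t, D s -> D t -> i (c *: s + t) = c *: i s + i t) ->
  (forall (c : C) s t, D s -> D t -> j (c *: s + t) = c *: j s + j t) ->
  closure (i @` D) = [set: V] -> closure (j @` D) = [set: W] ->
  (forall s, D s -> `|i s| = `|j s|) ->
  exists (f : V -> W) (g : W -> V), [/\ linear f, continuous f, cancel f g,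
    cancel g f & forall s, D s -> f (i s) = j s].
Proof.
move=> Dl il jl iD jD ij.
have ijB s t : D s -> D t -> `|i s - i t| = `|j s - j t|.
  move=> Ds Dt; rewrite addrC [j s - _]addrC -scaleN1r -il// -[- j t]scaleN1r -jl//.
  by rewrite ij//; exact: Dl.
have jiB s t : D s -> D t -> `|j s - j t| = `|i s - i t| by move=> ? ?; rewrite ijB.
have [f fP] := choice (dense_isometry_exists iD ijB).
have [g gP] := choice (dense_isometry_exists jD jiB).
have fi s : D s -> f (i s) = j s.
  move=> Ds; apply/esym/eqP; rewrite -subr_eq0 -normr_eq0 -fP//.
  by rewrite subrr normr0.
have fc : continuous f.
  move=> x; apply/(@cvgrPdist_lt _ W V (nbhs x) (nbhs_filter x) f (f x)) => e e0.
  have := @cvgr_dist_lt _ V V (nbhs x) (nbhs_filter x) id x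
    (@cvg_id V (nbhs x)) _ e0.
  apply: filterS => y; apply: le_lt_trans; apply/ler_addgt0Pr => d d0.
  have d2 : 0 < d / 2 by rewrite divr_gt0.
  have [s Ds sx] := dense_image_dist iD x d2.
  apply: (le_trans (ler_distD (j s) _ _)).
  rewrite [`|f x - _|]distrC -!fP//.
  have -> : `|x - y| + d = d / 2 + (`|x - y| + d / 2) by rewrite addrCA -splitr.
  apply: lerD; first exact: ltW.
  by apply: (le_trans (ler_distD x _ _)); rewrite addrC lerD2l ltW.
exists f, g; split=> //.
- move=> c x y.
  have cD (U : normedModType C) (z : U) : continuous (fun w : U => z + w).
    by move=> w; apply: cvgD; [exact: cvg_cst|exact: cvg_id].
  have cZD (U : normedModType C) (z : U) : continuous (fun w : U => c *: w + z).
    by move=> w; apply: cvgD; [apply: cvgZr; exact: cvg_id|exact: cvg_cst].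
  have H1 s : D s -> forall y, f (c *: i s + y) = c *: f (i s) + f y.
    move=> Ds; apply: (continuous_dense_eq _ _ iD).
    + exact: (continuous_compT (@cD _ _) fc).
    + exact: (continuous_compT fc (@cD _ _)).
    + by move=> _ [t Dt <-]; rewrite -il// !fi//; [exact: jl|exact: Dl].
  move: x; apply: (continuous_dense_eq _ _ iD).
  + exact: (continuous_compT (@cZD _ _) fc).
  + exact: (continuous_compT fc (@cZD _ _)).
  + by move=> _ [s Ds <-]; exact: H1.
- by move=> x; apply: (dense_image_eq iD) => s Ds; rewrite -gP// -fP.
- by move=> x; apply: (dense_image_eq jD) => s Ds; rewrite -fP// -gP.
Qed.

End dense_isometry.

(** * From dense subspaces to isomorphisms of correspondences *)

Section correspondence_extension.
Context (R : realType).
Local Notation C := (cplx R).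

Lemma correspondence_extension (A A' : cstarAlgType R) (E : correspondenceType A)
    (E' : correspondenceType A') (alpha : A -> A') (beta : A' -> A)
    (S : lmodType C) (D : set S) (i : S -> E) (j : S -> E') :
  star_hom alpha -> (forall a, `|alpha a| = `|a|) ->
  cancel alpha beta -> cancel beta alpha ->
  (forall (c : C) s t, D s -> D t -> D (c *: s + t)) ->
  (forall (c : C) s t, D s -> D t -> i (c *: s + t) = c *: i s + i t) ->
  (forall (c : C) s t, D s -> D t -> j (c *: s + t) = c *: j s + j t) ->
  closure (i @` D) = [set: E] -> closure (j @` D) = [set: E'] ->
  (forall s t, D s -> D t -> cip (j s) (j t) = alpha (cip (i s) (i t))) ->
  (forall a s, D s -> exists2 t, D t &
    lact a (i s) = i t /\ lact (alpha a) (j s) = j t) ->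
  exists U V, @correspondence_iso R A A' E E' alpha beta U V.
Proof.
move=> ah an aK bK Dl il jl iD jD ijc ija.
have ij s : D s -> `|i s| = `|j s|.
  move=> Ds; apply/eqP; rewrite -(eqrXn2 (n := 2))//; apply/eqP.
  by rewrite !cip_norm ijc// an.
have [U [V [Ul Uc UK VK Ui]]] := dense_isometry_extension Dl il jl iD jD ij.
have ac : continuous alpha by apply: isometry_continuous an; exact: star_hom_linear ah.
have UcipD s y : D s -> cip (U (i s)) (U y) = alpha (cip (i s) y).
  move=> Ds; move: y; apply: (continuous_dense_eq _ _ iD).
  - exact: (continuous_compT Uc (@cip_continuousr _ _ _ _)).
  - exact: (continuous_compT (@cip_continuousr _ _ _ _) ac).
  - by move=> _ [t Dt <-]; rewrite !Ui// ijc.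
have Ucip x y : cip (U x) (U y) = alpha (cip x y).
  move: x; apply: (continuous_dense_eq _ _ iD).
  - exact: (continuous_compT Uc (@cip_continuousl _ _ _ _)).
  - exact: (continuous_compT (@cip_continuousl _ _ _ _) ac).
  - by move=> _ [s Ds <-]; exact: UcipD.
exists U, V; split=> // a x.
                                                                          
               
(* The correspondence axioms state no bound for [lact a], so one does not argue by continuity in
   [x]. The action is moved to the other argument as [lact (cadj a)], where [z] may be restricted to
   the dense image of [j] and [ija] applies. *)
apply: cip_inj => z; move: z; apply: (continuous_dense_eq _ _ jD).
- exact: cip_continuousl.
- exact: cip_continuousl.
- move=> _ [s Ds <-]; rewrite lact_adjr -(star_hom_adj ah).
  have [t Dt [ti tj]] := ija (cadj a) s Ds.
  by rewrite tj -!Ui// !Ucip lact_adjr ti.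
Qed.

End correspondence_extension.

                                                   

(** * Integration against Borel measures on topological spaces *)

Section borel_integrals.
Context (R : realType).

Section one_space.
Context (T : topologicalType) (x0 : T).
Local Notation B := (borel_at x0).

Lemma continuous_borel_measurable (T' : topologicalType) (x0' : T') (f : T -> T') :
  continuous f -> measurable_fun [set: B] (f : B -> borel_at x0').
Proof.
move=> /continuousP fc;
apply: (@measurability _ _ B (borel_at x0') setT f (@open (pointed_at x0')))
  => //.
move=> _ [U oU <-]; rewrite setTI; apply: sub_sigma_algebra.
exact: (fc U oU).
Qed.

Lemma continuous_real_measurable (f : T -> R) :
  continuous f -> measurable_fun [set: B] (f : B -> R).
Proof.
move=> /continuousP fc; apply: (measurability _ (RGenOpens.measurableE R)).
move=> _ [_ [a [b ->] <-]]; rewrite setTI; apply: sub_sigma_algebra.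
exact/fc/interval_open.
Qed.

Lemma closed_borel_measurable (D : set T) : closed D -> measurable (D : set B).
Proof.
by rewrite -openC => oD; rewrite -[D]setCK; apply: measurableC; exact: sub_sigma_algebra.
Qed.

(** [f] vanishes off its compact support, which has finite measure and on which [f] is bounded. *)
Lemma Cc_integrable (m : {measure set B -> \bar R}) (f : T -> R) :
  (forall K : set T, compact K -> (m K < +oo)%E) ->
  continuous f -> compact (closure [set x | f x != 0]) ->
  m.-integrable [set: B] (EFin \o f).
Proof.
move=> mK fc fs; set K := closure _ in fs.
have mcK : measurable (K : set B).
  by apply: closed_borel_measurable; exact: closed_closure.
have mf := continuous_real_measurable fc.
have -> : EFin \o f = (EFin \o f) \_ K.
  apply/funext => x; rewrite patchE; case: ifPn => //= xK.
  apply/eqP; rewrite eqe; apply: contraNT xK => fx0.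
  by apply/mem_set; exact: subset_closure.
apply/integrable_restrict => //; rewrite setTI.
apply: measurable_bounded_integrable => //.
- exact: mK.
- exact: measurable_funTS.
- have : compact (f @` K).
    by apply: continuous_compact fs; exact: continuous_subspaceT.
  move=> /compact_bounded[M [Mr MP]]; exists M; split => // y My x Kx /=.
  by apply: MP => //; exists x.
Qed.

(** On the open set where [f] exceeds [f e / 2], which has positive measure since it contains the
    support point [e], the integral is at least [f e / 2] times that measure. *)
Lemma measure_support_integral_gt0 (m : {measure set B -> \bar R})
    (f : T -> R) (e : T) :
  continuous f -> (forall x, 0 <= f x) -> 0 < f e ->
  measure_support (m : set T -> \bar R) e ->
  (0 < \int[m]_(x in [set: B]) (f x)%:E)%E.
Proof.
move=> fc f0 fe eS.
pose U : set B := [set x | f e / 2 < f x].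
have oU : open (U : set T).
  have -> : U = f @^-1` [set r | f e / 2 < r] by [].
  by apply: open_comp; [move=> x _; exact: fc|exact: open_gt].
have mU : measurable U by exact: sub_sigma_algebra.
have fe2 : 0 < f e / 2 by rewrite divr_gt0.
have mf : measurable_fun [set: B] (fun x : B => (f x)%:E).
  by apply/measurable_EFinP; exact: continuous_real_measurable.
have : (0 < (f e / 2)%:E * m U)%E.
  apply: mule_gt0; first by rewrite lte_fin.
  apply: eS; split=> //; rewrite /U /=.
  by rewrite ltr_pdivrMr// mulr_natr mulr2n ltrDl.
move=> h0; apply: (lt_le_trans h0).
rewrite -integral_cst//; apply: (@le_trans _ _ (\int[m]_(x in U) (f x)%:E)%E).
  apply: ge0_le_integral => //.
  - by move=> x _; rewrite lee_fin ltW.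
  - exact: measurable_funTS.
  - by move=> x; rewrite /U /= lee_fin => /ltW.
by apply: ge0_subset_integral => // x _; rewrite lee_fin.
Qed.

End one_space.

(** One base point serves all measures, sets and integrands, so several integrals can be rewritten
    consistently. *)
Lemma borel_integralE (T : topologicalType) (x : T) : exists x0 : T,
  forall (mu : set T -> \bar R) (D : set T) (f : T -> \bar R),
  borel_integral mu D f = (\int[(mu : set (borel_at x0) -> \bar R)]_(y in D) f y)%E.
Proof.
rewrite /borel_integral; case: pselect => [xT|[]]; last by exists x.
by exists (projT1 (cid xT)).
Qed.

Lemma borel_integral_empty (T : topologicalType) (mu : set T -> \bar R) D f :
  ~ (exists x : T, True) -> borel_integral mu D f = 0%E.
Proof. by move=> T0; rewrite /borel_integral; case: pselect. Qed.

End borel_integrals.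

(** * Change of variables for a scaled image measure *)

Section scaled_pushforward.
Local Open Scope ereal_scope.
Context d d' (X : measurableType d) (Y : measurableType d') (R : realType)
  (m : {measure set X -> \bar R}) (m' : {measure set Y -> \bar R})
  (phi : X -> Y) (c : {nonneg R}).
Hypothesis mphi : measurable_fun [set: X] phi.
Hypothesis m'E : forall A, measurable A -> m' A = c%:num%:E * m (phi @^-1` A).

Lemma ge0_integral_scaled_pushforward (D : set Y) (f : Y -> \bar R) :
  measurable D -> measurable_fun [set: Y] f -> (forall y, 0 <= f y) ->
  \int[m']_(y in D) f y = c%:num%:E * \int[m]_(x in phi @^-1` D) (f \o phi) x.
Proof.
move=> mD mf f0.
have mpD : measurable (phi @^-1` D) by rewrite -[X in measurable X]setTI; exact: mphi.
rewrite -ge0_integral_mscale//; last 2 first.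
- by apply: measurable_funTS; exact: measurableT_comp.
- by move=> x _ /=.
have @n : {measure set Y -> \bar R} by unshelve refine (pushforward (mscale c m) phi).
rewrite (eq_measure_integral n); last by move=> A mA _; rewrite m'E.
by apply: ge0_integral_pushforward => //; exact: measurable_funTS.
Qed.

(** Positive and negative parts are treated separately; integrability keeps their difference
    meaningful when [c] is factored out. *)
Lemma integral_scaled_pushforward (D : set Y) (f : Y -> \bar R) :
  measurable D -> measurable_fun [set: Y] f ->
  m.-integrable (phi @^-1` D) (f \o phi) ->
  \int[m']_(y in D) f y = c%:num%:E * \int[m]_(x in phi @^-1` D) (f \o phi) x.
Proof.
move=> mD mf fi.
have mpD : measurable (phi @^-1` D) by rewrite -[X in measurable X]setTI; exact: mphi.
have hp : \int[m']_(y in D) f^\+ y =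
    c%:num%:E * \int[m]_(x in phi @^-1` D) (f \o phi)^\+ x.
  have := @ge0_integral_scaled_pushforward D f^\+ mD (measurable_funepos mf).
  move=> -> => [|y]; last exact: funepos_ge0.
  by congr mule; apply: eq_integral => x _; rewrite [in RHS]funepos_comp.
have hn : \int[m']_(y in D) f^\- y =
    c%:num%:E * \int[m]_(x in phi @^-1` D) (f \o phi)^\- x.
  have := @ge0_integral_scaled_pushforward D f^\- mD (measurable_funeneg mf).
  move=> -> => [|y]; last exact: funeneg_ge0.
  by congr mule; apply: eq_integral => x _; rewrite [in RHS]funeneg_comp.
rewrite integralE hp hn -muleBr//; first by congr mule; exact/esym/integralE.
by rewrite fin_num_adde_defl// fin_numN integrable_neg_fin_num.
Qed.

End scaled_pushforward.

(** * Transport of Borel integrals along a homeomorphism *)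

Section borel_transport.
Context (R : realType) (T T' : topologicalType) (psi : T -> T')
  (psiP : homeomorphism psi).

(** The support of the composite lies in the image of the old support under the inverse. The
    codomain is arbitrary so as to cover real and complex functions. *)
Lemma homeomorphism_compact_support (U : Type) (z : U) (f : T' -> U) :
  compact (closure [set x | f x <> z]) -> compact (closure [set x | f (psi x) <> z]).
Proof.
move: psiP => [psic [g [gc psiK gK]]] fc.
apply: (@subclosed_compact _ _ (g @` closure [set x | f x <> z])).
- exact: closed_closure.
- by apply: continuous_compact fc; exact: continuous_subspaceT.
rewrite [X in _ `<=` X](_ : _ = psi @^-1` closure [set x | f x <> z]).
  have cl : closed (psi @^-1` closure [set x | f x <> z]).
    by apply: preimage_closed; [move=> x _; exact: psic|exact: closed_closure].
  rewrite ((closure_id _).1 cl); apply: closureS => x.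
  by move=> fx; apply: subset_closure.
by apply/seteqP; split=> [_ [x clx <-]|x clx]; [rewrite /preimage/= gK|exists (psi x)].
Qed.

Context (mu : set T -> \bar R) (mu' : set T' -> \bar R) (c : R).
Hypotheses (c0 : 0 < c) (muP : radon_measure mu) (mu'P : radon_measure mu').
Hypothesis mu'E : forall B : set T', borel B ->
  mu' B = borel_integral (fun A => mu (psi @^-1` A)) B (fun=> c%:E).

(** Finiteness is stated alongside because [cplx_integral] applies [fine], which is multiplicative
    only on finite values. *)
Lemma borel_integral_transport (g : T' -> R) (D : set T') :
  continuous g -> compact (closure [set x | g x <> 0]) -> closed D ->
  borel_integral mu (psi @^-1` D) (fun x => (g (psi x))%:E) \is a fin_num /\
  borel_integral mu' D (fun x => (g x)%:E) =
  (c%:E * borel_integral mu (psi @^-1` D) (fun x => (g (psi x))%:E))%E.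
Proof.
move=> gc gs clD; have [[x _]|T0] := pselect (exists x : T, True); last first.
  have T0' : ~ exists x : T', True.
    by move=> [x' _]; apply: T0; move: psiP => [_ [k _]]; exists (k x').
  by rewrite !borel_integral_empty// mule0.
have [x0 muI] := borel_integralE R x.
have [x0' mu'I] := borel_integralE R (psi x).
rewrite !muI mu'I.
have [_ /(_ x0)[m mE]] := radon_borel muP.
have [_ /(_ x0')[m' m'E]] := radon_borel mu'P.
have mK K : compact K -> (m K < +oo)%E by move=> /(radon_finite muP); rewrite mE.
rewrite mE m'E.
have psic : continuous psi by case: psiP.
have mpsi := @continuous_borel_measurable _ x0 _ x0' _ psic.
have mg := @continuous_real_measurable R _ x0' _ gc.
have mD := @closed_borel_measurable _ x0' _ clD.
have mpD : measurable (psi @^-1` D : set (borel_at x0)).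
  by apply: closed_borel_measurable; apply: preimage_closed clD => y _; exact: psic.
have gi : m.-integrable (psi @^-1` D : set (borel_at x0)) (EFin \o (g \o psi)).
  apply: (@integrableS _ _ _ m setT) => //.
  apply: Cc_integrable => //; first exact: continuous_compT.
  have -> : [set x | (g \o psi) x != 0] = [set x | g (psi x) <> 0].
    by apply/seteqP; split=> y /= /eqP.
  exact: homeomorphism_compact_support.
split; first exact: integrable_fin_num gi.
pose c' : {nonneg R} := NngNum (ltW c0).
apply: (@integral_scaled_pushforward _ _ (borel_at x0) (borel_at x0') R m m' psi c')
  => //; last exact/measurable_EFinP.
(* Integrating the constant [c] over [A] against the image measure gives [c] times the measure of
   the preimage of [A]. *)
move=> A mA; rewrite -m'E mu'E// mu'I mE.
rewrite [LHS](ge0_integral_pushforward mpsi m mA (f := cst c%:E))//.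
- rewrite /comp/= integral_cst// -[X in measurable X]setTI; exact: mpsi.
- by move=> y _; rewrite lee_fin ltW.
Qed.

End borel_transport.

(** * Continuous functions with compact support *)

Section compact_support.
Context (R : realType).
Local Notation C := (cplx R).

Lemma Re_continuous (T : topologicalType) (f : T -> C) :
  continuous f -> continuous (fun x => complex.Re (f x)).
Proof.
move=> fc x; apply/(@cvgrPdist_lt _ _ _ _ (nbhs_filter x)) => e e0.
have := (@cplx_dist_lt _ _ _ (nbhs_filter x) f (f x)).1 (fc x) _ e0.
apply: filterS => y; apply: le_lt_trans.
apply: le_trans (cabs_Re _).
by case: (f x) (f y) => a b [].
Qed.

Lemma Im_continuous (T : topologicalType) (f : T -> C) :
  continuous f -> continuous (fun x => complex.Im (f x)).
Proof.
move=> fc x; apply/(@cvgrPdist_lt _ _ _ _ (nbhs_filter x)) => e e0.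
have := (@cplx_dist_lt _ _ _ (nbhs_filter x) f (f x)).1 (fc x) _ e0.
apply: filterS => y; apply: le_lt_trans.
apply: le_trans (cabs_Im _).
by case: (f x) (f y) => a b [].
Qed.

Lemma cabs_real (r : R) : cabs ((r%:C)%C : C) = `|r|.
Proof. by rewrite /cabs (@normc_def R) /= expr0n addr0 sqrtr_sqr. Qed.

Lemma real_complex_continuous (T : topologicalType) (f : T -> R) :
  continuous f -> continuous (fun x => ((f x)%:C)%C : C).
Proof.
move=> fc x; apply/(@cplx_dist_lt _ _ _ (nbhs_filter x)) => e e0.
have := @cvgr_dist_lt _ _ _ (nbhs x) (nbhs_filter x) f (f x) (fc x) e e0.
by apply: filterS => y; rewrite -(rmorphB (real_complex R)) cabs_real.
Qed.

Lemma CcP (T : topologicalType) (f : T -> C) :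
  Cc R T f <-> continuous f /\ compact (closure [set x | f x <> 0]).
Proof.
rewrite /Cc /=; have -> // : [set x | f x != 0] = [set x | f x <> 0].
by apply/seteqP; split=> x /= /eqP.
Qed.

Lemma sub_compact_support (T : topologicalType) (A B : set T) :
  A `<=` B -> compact (closure B) -> compact (closure A).
Proof.
move=> AB cB; apply: (subclosed_compact _ cB); first exact: closed_closure.
exact: closureS.
Qed.

Lemma Cc_mul (T : topologicalType) (w f : T -> C) :
  continuous w -> Cc R T f -> Cc R T (fun x => w x * f x).
Proof.
move=> wc /CcP[fc fs]; apply/CcP; split.
  by move=> x; apply: cvgM; [exact: wc|exact: fc].
apply: sub_compact_support fs => x /= wf0 f0; apply: wf0.
by rewrite f0 mulr0.
Qed.

Lemma Cc_lin (T : topologicalType) (c : C) (f g : T -> C) :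
  Cc R T f -> Cc R T g -> Cc R T (c *: f + g).
Proof.
move=> /CcP[fc fs] /CcP[gc gs]; apply/CcP; split.
  move=> x; apply: cvgD; last exact: gc.
  by apply: cvgM; [exact: cvg_cst|exact: fc].
have := compactU fs gs; rewrite -closureU; apply: sub_compact_support => x /= fg0.
apply: contrapT => /not_orP[/contrapT f0 /contrapT g0]; apply: fg0.
by rewrite [LHS](_ : _ = c * f x + g x)// f0 g0 mulr0 addr0.
Qed.

Lemma conj_continuous (T : topologicalType) (f : T -> C) :
  continuous f -> continuous (fun x => (f x)^*).
Proof.
move=> fc x; apply/(@cplx_dist_lt _ _ _ (nbhs_filter x)) => e e0.
have := (@cplx_dist_lt _ _ _ (nbhs_filter x) f (f x)).1 (fc x) _ e0.
by apply: filterS => y; rewrite -rmorphB cabsJ.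
Qed.

Lemma Cc_comp (T T' : topologicalType) (psi : T -> T') (f : T' -> C) :
  homeomorphism psi -> Cc R T' f -> Cc R T (f \o psi).
Proof.
move=> psiP /CcP[fc fs]; apply/CcP; split.
  by apply: continuous_compT fc; case: psiP.
exact: (homeomorphism_compact_support psiP fs).
Qed.

(** Complete regularity separates [x] from the complement of the interior of a compact
    neighbourhood. The separating function is 0 at [x] and 1 on that complement, hence the passage
    to [1 - f]. *)
Lemma Cc_bump (T : topologicalType) (x : T) :
  locally_compact [set: T] -> hausdorff_space T ->
  exists f : T -> R, [/\ continuous f, forall y, 0 <= f y, f x = 1 &
    compact (closure [set y | f y <> 0])].
Proof.
move=> lc hs; have [U] := lc x I.
move=> nU' [cU clU].
have nU : nbhs x U by apply: (@filterS _ (nbhs x) _ _ _ _ nU') => y; apply.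
have cV : closed (~` U^°) by rewrite closedC; exact: open_interior.
have := @locally_compact_completely_regular T R lc hs x (~` U^°) cV.
have Vx : ~ (~` U^°) x by apply; exact: nU.
move=> /(_ Vx)/(@uniform_separatorP T R)[f [fc f01 fx fV]].
exists (fun y => 1 - f y); split=> [y|y||].
- by apply: cvgB; [exact: cvg_cst|exact: fc].
- have /f01 : range f (f y) by exists y.
  by rewrite /= in_itv/= subr_ge0 => /andP[].
- by rewrite (fx (f x)) ?subr0//; exists x.
apply: (@sub_compact_support _ _ U); last by rewrite -((closure_id _).1 clU).
move=> y /= fy; apply: interior_subset; apply: contrapT => nUy; apply: fy.
by rewrite (fV (f y)) ?subrr//; exists y.
Qed.

End compact_support.

(** * Complex integrals, by real and imaginary parts *)

Section cplx_integrals.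
Context (R : realType).
Local Notation C := (cplx R).

Lemma Cc_Re (T : topologicalType) (F : T -> C) : Cc R T F ->
  continuous (fun x => complex.Re (F x)) /\
  compact (closure [set x | complex.Re (F x) <> 0]).
Proof.
move=> /CcP[Fc Fs]; split; first exact: Re_continuous.
by apply: sub_compact_support Fs => x /= ReF F0; apply: ReF; rewrite F0.
Qed.

Lemma Cc_Im (T : topologicalType) (F : T -> C) : Cc R T F ->
  continuous (fun x => complex.Im (F x)) /\
  compact (closure [set x | complex.Im (F x) <> 0]).
Proof.
move=> /CcP[Fc Fs]; split; first exact: Im_continuous.
by apply: sub_compact_support Fs => x /= ImF F0; apply: ImF; rewrite F0.
Qed.

Lemma eq_borel_integral (T : topologicalType) (mu : set T -> \bar R) (D : set T)
    (f g : T -> \bar R) :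
  (forall x, D x -> f x = g x) -> borel_integral mu D f = borel_integral mu D g.
Proof.
move=> fg; rewrite /borel_integral; case: pselect => // xT.
by rewrite /integral (_ : f \_ D = g \_ D)//; apply/eq_restrictP => x /[!inE]/fg.
Qed.

Lemma eq_cplx_integral (T : topologicalType) (mu : set T -> \bar R) (D : set T)
    (F G : T -> C) :
  (forall x, D x -> F x = G x) -> cplx_integral mu D F = cplx_integral mu D G.
Proof.
move=> FG; rewrite /cplx_integral.
by congr (Complex (fine _) (fine _)); apply: eq_borel_integral => x /FG ->.
Qed.

Lemma borel_integralZ (T : topologicalType) (mu : set T -> \bar R) (D : set T)
    (f : T -> R) (c : R) :
  radon_measure mu -> closed D ->
  continuous f -> compact (closure [set x | f x <> 0]) ->
  borel_integral mu D (fun x => (f x)%:E) \is a fin_num /\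
  borel_integral mu D (fun x => (c * f x)%:E) =
  (c%:E * borel_integral mu D (fun x => (f x)%:E))%E.
Proof.
move=> muP clD fc fs; have [[x _]|T0] := pselect (exists x : T, True); last first.
  by rewrite !borel_integral_empty// mule0.
have [x0 muI] := borel_integralE R x; rewrite !muI.
have [_ /(_ x0)[m mE]] := radon_borel muP.
have mD := @closed_borel_measurable _ x0 _ clD.
have fi : m.-integrable (D : set (borel_at x0)) (EFin \o f).
  apply: (@integrableS _ _ _ m setT) => //.
  apply: Cc_integrable => //; first by move=> K /(radon_finite muP); rewrite mE.
  have -> // : [set x | f x != 0] = [set x | f x <> 0].
  by apply/seteqP; split=> y /= /eqP.
rewrite mE; split; first exact: integrable_fin_num fi.
by under eq_integral do rewrite EFinM; exact: integralZl.
Qed.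

Lemma complex_realM (c a b : R) :
  (c%:C)%C * Complex a b = Complex (c * a) (c * b) :> C.
Proof. by apply/eqP; rewrite eq_complex /= !mul0r subr0 addr0 !eqxx. Qed.

Lemma Re_realM (c : R) (z : C) : complex.Re ((c%:C)%C * z) = c * complex.Re z.
Proof. by case: z => a b; rewrite complex_realM. Qed.

Lemma Im_realM (c : R) (z : C) : complex.Im ((c%:C)%C * z) = c * complex.Im z.
Proof. by case: z => a b; rewrite complex_realM. Qed.

Lemma cplx_integral_transport (T T' : topologicalType) (psi : T -> T')
    (mu : set T -> \bar R) (mu' : set T' -> \bar R) (c : R) :
  homeomorphism psi -> 0 < c -> radon_measure mu -> radon_measure mu' ->
  (forall B : set T', borel B ->
    mu' B = borel_integral (fun A => mu (psi @^-1` A)) B (fun=> c%:E)) ->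
  forall (F : T' -> C) (D : set T'), Cc R T' F -> closed D ->
  cplx_integral mu' D F = (c%:C)%C * cplx_integral mu (psi @^-1` D) (F \o psi).
Proof.
move=> psiP c0 muP mu'P mu'E F D FC clD.
have [Rc Rs] := Cc_Re FC; have [Ic Is] := Cc_Im FC.
have [Rfin RE] := borel_integral_transport psiP c0 muP mu'P mu'E Rc Rs clD.
have [Ifin IE] := borel_integral_transport psiP c0 muP mu'P mu'E Ic Is clD.
by rewrite /cplx_integral RE IE !fineM// complex_realM.
Qed.

Lemma cplx_integralZ (T : topologicalType) (mu : set T -> \bar R) (D : set T)
    (F : T -> C) (c : R) :
  radon_measure mu -> closed D -> Cc R T F ->
  cplx_integral mu D (fun x => (c%:C)%C * F x) = (c%:C)%C * cplx_integral mu D F.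
Proof.
move=> muP clD FC; have [Rc Rs] := Cc_Re FC; have [Ic Is] := Cc_Im FC.
have [Rfin RE] := borel_integralZ c muP clD Rc Rs.
have [Ifin IE] := borel_integralZ c muP clD Ic Is.
rewrite {2}/cplx_integral complex_realM -[c]/(fine c%:E) -!fineM// -RE -IE.
by congr (Complex (fine _) (fine _)); apply: eq_borel_integral => x _;
  rewrite ?Re_realM ?Im_realM.
Qed.

End cplx_integrals.

                

(** * Continuity of the weight and the weighted transport between quivers *)

Lemma conj_mul_real (F : numClosedFieldType) (a x y : F) :
  a^* = a -> (a * x)^* * (a * y) = a * a * (x^* * y).
Proof. by move=> aJ; rewrite rmorphM /= aJ mulrACA. Qed.

Section quivers.
Context (R : realType) (Q Q' : topological_quiver R)
    (phi : vert Q -> vert Q') (psi : edge Q -> edge Q') (h : vert Q -> R)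
    (phiP : homeomorphism phi) (psiP : measurable_homeomorphism psi)
    (h_gt0 : forall y : vert Q, 0 < h y)
    (hr : forall e : edge Q, phi (qr e) = qr (psi e))
    (hlambda : forall (y : vert Q) (B : set (edge Q')), borel B ->
      qlambda (phi y) B =
      borel_integral (fun A => qlambda y (psi @^-1` A)) B (fun=> (h y)%:E)).
Local Notation C := (cplx R).
Let psih : homeomorphism psi := proj1 psiP.
Let phic : continuous phi := proj1 phiP.

Lemma qlambda_transport y (F : edge Q' -> C) (D : set (edge Q')) :
  Cc R (edge Q') F -> closed D ->
  cplx_integral (qlambda (phi y)) D F =
  ((h y)%:C)%C * cplx_integral (qlambda y) (psi @^-1` D) (F \o psi).
Proof.
exact: (cplx_integral_transport psih (h_gt0 y) (qlambda_radon y)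
  (qlambda_radon (phi y)) (@hlambda y)).
Qed.

                                                                                
                                                                                
(** Continuity is claimed only at points of the range of [qr]: elsewhere the measures vanish and [h]
    is arbitrary. Near [qr e], [h] is the quotient of the continuous functions [N] and [M] built
    from a bump function at [psi e]. *)
Lemma weight_continuous e : h y @[y --> qr e] --> h (qr e).
Proof.
have [f [fc f0 fe fs]] :=
  Cc_bump R (psi e) (@edge_locally_compact R Q') (@edge_hausdorff R Q').
pose F x : C := ((f x)%:C)%C.
have FC : Cc R (edge Q') F.
  apply/CcP; split; first exact: real_complex_continuous.
  apply: sub_compact_support fs => x /= Fx fx; apply: Fx.
  by rewrite /F fx.
pose N y := complex.Re (cplx_integral (qlambda (phi y)) setT F).
pose M y := complex.Re (cplx_integral (qlambda y) setT (F \o psi)).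
have Nc : continuous N.
  have [gc _] := @qlambda_Cc _ Q' F FC.
  exact: (Re_continuous (continuous_compT phic gc)).
have Mc : continuous M.
  have [gc _] := @qlambda_Cc _ Q (F \o psi) (Cc_comp psih FC).
  exact: Re_continuous gc.
have NM y : N y = h y * M y.
  by rewrite /N qlambda_transport// preimage_setT Re_realM.
have M0 : 0 < M (qr e).
  have psic : continuous psi by case: psih.
  have fpc : continuous (f \o psi) by exact: continuous_compT psic fc.
  (* The factor 1 is a dummy; only the finiteness of the integral is extracted. *)
  have [fin _] := borel_integralZ 1 (qlambda_radon (qr e)) (@closedT _) fpc
    (homeomorphism_compact_support psih fs).
  rewrite -lte_fin /M /cplx_integral fineK//.
  have [x0 muI] := borel_integralE R e; rewrite muI.
  have [_ /(_ x0)[m mE]] := radon_borel (qlambda_radon (qr e)); rewrite mE.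
  apply: (@measure_support_integral_gt0 _ _ x0 m (f \o psi) e) => //.
  - by move=> x; exact: f0.
  - by rewrite /= fe ltr01.
  - by rewrite -mE qlambda_support.
have hNM y : 0 < M y -> N y / M y = h y.
  by move=> My; rewrite NM mulfK// gt_eqF.
rewrite -(hNM _ M0).
have NMc : N y / M y @[y --> qr e] --> N (qr e) / M (qr e).
  by apply: cvgM; [exact: Nc|apply: cvgV; [rewrite gt_eqF|exact: Mc]].
apply: cvg_trans NMc; apply: near_eq_cvg.
have nM := @cvgr_gt _ _ _ (nbhs_filter (qr e)) M (M (qr e)) (Mc (qr e)) 0 M0.
by apply: (@filterS _ (nbhs (qr e)) _ _ _ _ nM) => y; exact: hNM.
Qed.

Let g : edge Q' -> edge Q := projT1 (cid (proj2 psih)).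
Let gP : [/\ continuous g, cancel psi g & cancel g psi] := projT2 (cid (proj2 psih)).
Let gh : homeomorphism g.
Proof.
have [gc psiK gK] := gP; split=> //; exists psi; split=> //; by case: psih.
Qed.

Let w e : R := Num.sqrt (h (qr e)).

Let w_gt0 e : 0 < w e.
Proof. by rewrite sqrtr_gt0. Qed.

Lemma sqrt_weight_continuous : continuous (fun e => Num.sqrt (h (qr e))).
Proof.
move=> e; apply: (@continuous_comp _ _ _ (h \o @qr R Q) Num.sqrt).
  by apply: continuous_comp; [exact: qr_continuous|exact: weight_continuous].
exact: sqrt_continuous.
Qed.

(** The square root, because the inner product multiplies two transported functions and must gain
    exactly the density $h_y$. *)
Definition quiver_transport (xi : edge Q' -> C) (e : edge Q) : C :=
  ((w e)%:C)%C * xi (psi e).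

Lemma quiver_transport_Cc xi :
  Cc R (edge Q') xi -> Cc R (edge Q) (quiver_transport xi).
Proof.
move=> xiC; apply: Cc_mul; last exact: Cc_comp psih xiC.
exact: real_complex_continuous sqrt_weight_continuous.
Qed.

(** The weight is continuous and positive, so it can be divided out. Surjectivity makes the
    transported functions dense in the completion. *)
Lemma quiver_transport_surj eta : Cc R (edge Q) eta ->
  exists2 xi, Cc R (edge Q') xi & quiver_transport xi = eta.
Proof.
have [gc psiK gK] := gP.
move=> etaC; exists (fun e' => (((w (g e'))^-1)%:C)%C * eta (g e')).
  apply: Cc_mul; last exact: Cc_comp gh etaC.
  apply: real_complex_continuous => e'; apply: cvgV; first by rewrite gt_eqF.
  exact: (continuous_compT gc sqrt_weight_continuous).
apply/funext => e; rewrite /quiver_transport psiK mulrA.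
by rewrite -(rmorphM (real_complex R)) mulfV ?gt_eqF// rmorph1 mul1r.
Qed.

Lemma quiver_transport_lin (c : C) xi eta :
  quiver_transport (c *: xi + eta) = c *: quiver_transport xi + quiver_transport eta.
Proof.
apply/funext => e; rewrite /quiver_transport.
rewrite [LHS](_ : _ = ((w e)%:C)%C * (c * xi (psi e) + eta (psi e)))//.
by rewrite mulrDr mulrCA.
Qed.

Lemma quiver_transport_cip y xi eta :
  Cc R (edge Q') xi -> Cc R (edge Q') eta ->
  cplx_integral (qlambda y) (@qr R Q @^-1` [set y])
    (fun e => (quiver_transport xi e)^* * quiver_transport eta e) =
  cplx_integral (qlambda (phi y)) (@qr R Q' @^-1` [set phi y])
    (fun e => (xi e)^* * eta e).
Proof.
move=> xiC etaC.
have FC : Cc R (edge Q') (fun e => (xi e)^* * eta e).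
  by apply: Cc_mul etaC; exact: conj_continuous xiC.1.
have cl1 (Q0 : topological_quiver R) (z : vert Q0) : closed (@qr R Q0 @^-1` [set z]).
  apply: preimage_closed; first by move=> x _; exact: qr_continuous.
  exact: accessible_closed_set1 (hausdorff_accessible (@vert_hausdorff R Q0)) z.
rewrite qlambda_transport//.
(* By (2) and injectivity of [phi], [psi] matches the fibres; on the fibre over [y] the squared
   weight is the constant [h y]. *)
have -> : psi @^-1` (@qr R Q' @^-1` [set phi y]) = @qr R Q @^-1` [set y].
  have [_ [k [_ phiK _]]] := phiP.
  by apply/seteqP; split=> e; rewrite /preimage /= -hr; [exact: (can_inj phiK)|move->].
rewrite -(cplx_integralZ _ (qlambda_radon y) (cl1 _ _) (Cc_comp psih FC)).
apply: eq_cplx_integral => e /= <-.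
have wE : ((h (qr e))%:C)%C = ((w e)%:C)%C * ((w e)%:C)%C :> C.
  by rewrite -(rmorphM (real_complex R)) -expr2 sqr_sqrtr// ltW.
have wJ : (((w e)%:C)%C : C)^* = ((w e)%:C)%C.
  by apply: conj_Creal; apply: ger0_real; rewrite (@ler0c R) ltW.
by rewrite wE; exact: conj_mul_real wJ.
Qed.

End quivers.

(** * The isometric isomorphism $\varphi^\#$ and the final assembly *)

Section pullback.
Context (R : realType) (X X' : topologicalType) (phi : X -> X')
  (phiP : homeomorphism phi).

Lemma C0_pullback_star_hom : star_hom (C0_pullback (R := R) phiP).
Proof. by split=> [c a b|a b|a]; apply: C0_ext. Qed.

Lemma C0_pullback_norm (a : C0 R X') : `|C0_pullback phiP a| = `|a|.
Proof.
have [_ [g [_ _ gK]]] := phiP.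
rewrite !C0_normE; congr (_%:C)%C; apply/eqP; rewrite eq_le; apply/andP; split.
  by apply: supnorm_le => [|x]; [exact: supnorm_ge0|exact: (supnorm_ub a (phi x))].
apply: supnorm_le => [|x']; first exact: supnorm_ge0.
by rewrite -(gK x'); exact: (supnorm_ub (C0_pullback phiP a) (g x')).
Qed.

Lemma C0_pullback_can (g : X' -> X) (gP : homeomorphism g) :
  cancel g phi -> cancel (C0_pullback (R := R) phiP) (C0_pullback gP).
Proof. by move=> gK a; apply: C0_ext => x' /=; rewrite gK. Qed.

End pullback.

Theorem theorem2p22 (R : realType) (Q Q' : topological_quiver R)
    (phi : vert Q -> vert Q') (psi : edge Q -> edge Q') (h : vert Q -> R)
    (phiP : homeomorphism phi) (psiP : measurable_homeomorphism psi)
    (h_gt0 : forall y : vert Q, 0 < h y)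
    (hs : forall e : edge Q, phi (qs e) = qs (psi e))
    (hr : forall e : edge Q, phi (qr e) = qr (psi e))
    (hlambda : forall (y : vert Q) (B : set (edge Q')), borel B ->
      qlambda (phi y) B =
      borel_integral (fun A => qlambda y (psi @^-1` A)) B (fun=> (h y)%:E))
    (EQ : quiver_correspondence Q) (EQ' : quiver_correspondence Q')
    (K' : set (C0 R (vert Q')))
    (K'P : closed_ideal_of (Jideal EQ') K') :
  let K := [set C0_pullback phiP a | a in K'] in
  closed_ideal_of (Jideal EQ) K /\
  forall (O : relative_cuntz_pimsner EQ K)
         (O' : relative_cuntz_pimsner EQ' K'),
    cstar_isomorphic O O'.
Proof.
move=> K.
have [phic [g [gc phiK gK]]] := phiP.
have gP : homeomorphism g by split=> //; exists phi.
pose tr := quiver_transport psi h.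
have trC xi : Cc R (edge Q') xi -> Cc R (edge Q) (tr xi).
  exact: (quiver_transport_Cc phiP psiP h_gt0 hlambda).
(* The isomorphism runs from [EQ'] to [EQ], in the direction of [C0_pullback phiP], so that [K] is
   literally the image of [K']. *)
suff [U [V I]] : exists (U : EQ' -> EQ) (V : EQ -> EQ'), correspondence_iso
    (C0_pullback phiP) (C0_pullback gP) U V.
  split; first exact: (ci_closed_ideal I K'P).
  by move=> O O'; exact: (ci_cuntz_pimsner I O' O).
apply: (@correspondence_extension _ _ _ _ _ _ _ _ (Cc R (edge Q')) (qc_iota EQ')
  (qc_iota EQ \o tr)).
- exact: C0_pullback_star_hom.
- exact: C0_pullback_norm.
- exact: C0_pullback_can.
- exact: C0_pullback_can.
- by move=> c xi eta; exact: Cc_lin.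
- by move=> c xi eta; exact: qc_linear.
- move=> c xi eta xiC etaC /=; rewrite /tr quiver_transport_lin.
  by apply: qc_linear; exact: trC.
- exact: qc_dense.
- rewrite -(qc_dense EQ); congr closure; apply/seteqP; split.
    by move=> _ [xi /trC xiC <-]; exists (tr xi).
  move=> _ [eta /(quiver_transport_surj phiP psiP h_gt0 hlambda)[xi xiC <-] <-].
  by exists xi.
- move=> xi eta xiC etaC; apply: C0_ext => y /=.
  rewrite !qc_cip//; try exact: trC.
  exact: (quiver_transport_cip phiP psiP h_gt0 hr hlambda).
(* The left action stays inside $C_c$, and (1) turns $a\circ\varphi\circ s$ into $a\circ
   s'\circ\psi$, so it commutes with the transport. *)
- move=> a xi xiC; exists (fun e => a (qs e) * xi e).
    apply: Cc_mul xiC.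
    exact: (continuous_compT (@qs_continuous R Q') (c0P _ (c0_funP a)).1).
  split; first exact: qc_lact.
  rewrite /= qc_lact; last exact: trC.
  congr (qc_iota _ _); apply/funext => e /=.
  by rewrite /tr /quiver_transport hs; exact: mulrCA.
Qed.
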